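(* Let $d\ge1$, $b\ge2$ be integers and let $W\ge0$ be a random variable with $W\not\equiv1$ and $\mathbb E[W]=1$. Suppose $\mathbb E[W\log W]<d\log b$ and $\mathbb E[W^{1+\varepsilon}]<\infty$ for some $\varepsilon>0$. Let $p_0\in(1,2]$ be any exponent satisfying $\mathbb E[W^{p_0}]<b^{d(p_0-1)}$. Then almost surely on $\{\mathrm{MC}_W^b\neq0\}$, the canonical Mandelbrot cascade measure $\mathrm{MC}_W^b$ has polynomial Fourier decay with $$\dim_F(\mathrm{MC}_W^b)\ge\min\Big\{2,\ \sup_{1<p\le p_0}\Big[2d\Big(1-\frac1p\Big)-2\log_b\Big(\big(\mathbb E[W^p]\big)^{1/p}\Big)\Big]\Big\}>0.$$
   Context: Canonical Mandelbrot cascade: let $\mathscr D_m^b$ be the family of cubes $\prod_{\beta=1}^d[\frac{h_\beta-1}{b^m},\frac{h_\beta}{b^m})$, $h_\beta\in\{1,\dots,b^m\}$, and let $\{W_{\mathbf I}:\mathbf I\in\bigsqcup_{m\ge1}\mathscr D_m^b\}$ be i.i.d. copies of $W$. Put $P_0\equiv1$ and $P_m(\mathbf t)=\sum_{\mathbf I\in\mathscr D_m^b}W_{\mathbf I}\mathbf 1_{\mathbf I}(\mathbf t)$ for $m\ge1$. $\mathrm{MC}_W^b$ is the almost sure weak limit as $m\to\infty$ of $\big[\prod_{j=0}^mP_j(\mathbf t)\big]d\mathbf t$ on $[0,1]^d$. For a finite Borel measure $\nu$ on $[0,1]^d$, $\widehat\nu(\mathbf x)=\int e^{-2\pi i\mathbf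 x\cdot\mathbf t}\nu(d\mathbf t)$ and $\dim_F(\nu)=\sup\{D\in[0,d):|\widehat\nu(\mathbf x)|^2=O(|\mathbf x|^{-D})\text{ as }|\mathbf x|\to\infty\}$. A non-zero $\nu$ has polynomial Fourier decay if $|\widehat\nu(\mathbf x)|^2=O(|\mathbf x|^{-D})$ for some $D>0$. *)

(* Defs.v *)
From HB Require Import structures.
From mathcomp Require Import all_boot all_order all_algebra.
From mathcomp Require Import all_classical all_reals all_analysis.
From mathcomp Require Import complex.

Set Implicit Arguments.
Unset Strict Implicit.
Unset Printing Implicit Defensive.

Import Order.TTheory GRing.Theory Num.Theory.
Import numFieldNormedType.Exports.

Local Open Scope classical_set_scope.
Local Open Scope ring_scope.

(* Points of R^d are d.-tuple R, whose library sigma-algebra is generated by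
   the coordinates, i.e. the Borel sigma-algebra of R^d. *)

Section cons_lebesgue.
Context (R : realType) (n : nat).
Variable mu : {sigma_finite_measure set (n.-tuple R) -> \bar R}.

Definition tuple_of_pair (p : measurableTypeR R * n.-tuple R) : n.+1.-tuple R :=
  [tuple of p.1 :: p.2].

Definition pair_of_tuple (t : n.+1.-tuple R) : measurableTypeR R * n.-tuple R :=
  (thead t, [tuple of behead t]).

Lemma tuple_of_pairK : cancel tuple_of_pair pair_of_tuple.
Proof. by case=> x t; congr pair; apply: val_inj. Qed.

Lemma measurable_tuple_of_pair : measurable_fun setT tuple_of_pair.
Proof. by apply: measurable_cons. Qed.

Lemma measurable_pair_of_tuple : measurable_fun setT pair_of_tuple.
Proof.
by apply: measurable_fun_pair; [exact: measurable_tnth|exact: measurable_behead].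
Qed.

Definition cons_lebesgue : set (n.+1.-tuple R) -> \bar R :=
  pushforward (lebesgue_measure \x mu)%E tuple_of_pair.

Let mpreimage A : measurable A -> measurable (tuple_of_pair @^-1` A).
Proof.
by move=> mA; rewrite -[X in measurable X]setTI; exact: measurable_tuple_of_pair.
Qed.

Let cons_lebesgue0 : cons_lebesgue set0 = 0%E.
Proof. by rewrite /cons_lebesgue /pushforward preimage_set0 measure0. Qed.

Let cons_lebesgue_ge0 A : (0 <= cons_lebesgue A)%E.
Proof. by rewrite /cons_lebesgue /pushforward; apply: measure_ge0. Qed.

Let cons_lebesgue_sigma_additive : semi_sigma_additive cons_lebesgue.
Proof.
move=> F mF tF mUF; rewrite /cons_lebesgue /pushforward preimage_bigcup.
apply: measure_semi_sigma_additive.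
- by move=> k; apply: mpreimage; exact: mF.
- apply/trivIsetP => i j _ _ ij; rewrite -preimage_setI.
  by move/trivIsetP : tF => /(_ _ _ _ _ ij) ->//; rewrite preimage_set0.
- by rewrite -preimage_bigcup; exact: mpreimage.
Qed.

HB.instance Definition _ := isMeasure.Build _ _ _ cons_lebesgue
  cons_lebesgue0 cons_lebesgue_ge0 cons_lebesgue_sigma_additive.

Let cons_lebesgue_sigma_finite : sigma_finite setT cons_lebesgue.
Proof.
have /sigma_finiteP[F [TF ndF Foo]] := sigma_finiteT (@lebesgue_measure R).
have /sigma_finiteP[G [TG ndG Goo]] := sigma_finiteT mu.
exists (fun k => pair_of_tuple @^-1` (F k `*` G k)).
  apply/seteqP; split=> // t _.
  have [i _ Fi] : (\bigcup_k F k) (pair_of_tuple t).1 by rewrite -TF.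
  have [j _ Gj] : (\bigcup_k G k) (pair_of_tuple t).2 by rewrite -TG.
  exists (maxn i j) => //; split.
  - by move: Fi; exact/subsetPset/ndF/leq_maxl.
  - by move: Gj; exact/subsetPset/ndG/leq_maxr.
move=> k; have [mF Fk] := Foo k; have [mG Gk] := Goo k; split.
  rewrite -[X in measurable X]setTI; apply: measurable_pair_of_tuple => //.
  exact: measurableX.
rewrite /cons_lebesgue /pushforward (_ : _ @^-1` _ = F k `*` G k); last first.
  by rewrite -[RHS]preimage_id; apply/funext => p; rewrite /preimage /mkset tuple_of_pairK.
by rewrite product_measure1E// lte_mul_pinfty// ge0_fin_numE.
Qed.

HB.instance Definition _ := Measure_isSigmaFinite.Build _ _ _ cons_lebesgue
  cons_lebesgue_sigma_finite.

End cons_lebesgue.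

Fixpoint lebesgue_tuple (R : realType) (d : nat) :
    {sigma_finite_measure set (d.-tuple R) -> \bar R} :=
  match d with
  | 0%N => \d_([tuple])
  | d'.+1 => cons_lebesgue (lebesgue_tuple R d')
  end.

(* Characterizes lebesgue_tuple as Lebesgue measure on R^d. *)
Lemma lebesgue_tuple_box (R : realType) (d : nat) (A : 'I_d -> set R) :
  (forall i, measurable (A i)) ->
  lebesgue_tuple R d [set t | forall i, A i (tnth t i)] =
  (\prod_(i < d) lebesgue_measure (A i))%E.
Proof.
elim: d A => [|d IH] A mA /=.
  by rewrite big_ord0 diracE mem_set//= => -[].
have mB : measurable [set t : d.-tuple R | forall i, A (lift ord0 i) (tnth t i)].
  rewrite (_ : mkset _ =
      \bigcap_(i in [set: 'I_d]) (@tnth _ R ^~ i @^-1` A (lift ord0 i))).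
    apply: fin_bigcap_measurable => // i _.
    by rewrite -[X in measurable X]setTI; exact: measurable_tnth.
  by apply/seteqP; split=> t /= h i; [move=> _|]; exact: h.
rewrite big_ord_recl -IH// /cons_lebesgue /pushforward.
rewrite -product_measure1E//; last exact: mA.
have tnth_lift (x : measurableTypeR R) (t : d.-tuple R) (j : 'I_d) :
    tnth (tuple_of_pair (x, t)) (lift ord0 j) = tnth t j.
  by rewrite !(tnth_nth x).
congr (_ _); apply/seteqP; split=> -[x t].
  move=> h; split; first exact: (h ord0).
  by move=> i; rewrite -(tnth_lift x); exact: h.
move=> [Ax At] i; case: (unliftP ord0 i) => [j ->|->//].
by rewrite tnth_lift; exact: At.
Qed.

Section fourier.
Context (R : realType) (d : nat).
Local Notation Rd := (d.-tuple R).

Definition unit_cube : set Rd := [set t | forall i, 0 <= tnth t i <= 1].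

Definition dotp (x t : Rd) : R := \sum_(i < d) tnth x i * tnth t i.

Definition enorm (x : Rd) : R := Num.sqrt (dotp x x).

Definition fourier (nu : {finite_measure set Rd -> \bar R}) (x : Rd) : R[i] :=
  ((\int[nu]_(t in unit_cube) cos (- (2 * pi * dotp x t))) +i*
   (\int[nu]_(t in unit_cube) sin (- (2 * pi * dotp x t))))%C.

(* |fourier nu x|^2 = O(|x|^(-D)) as |x| -> oo *)
Definition fourier_decay (nu : {finite_measure set Rd -> \bar R}) (D : R) :=
  exists C M : R, forall x : Rd, M <= enorm x ->
    Normc.normc (fourier nu x) ^+ 2 <= C * enorm x `^ (- D).

Definition polynomial_fourier_decay nu := exists2 D : R, 0 < D & fourier_decay nu D.

Definition dimF (nu : {finite_measure set Rd -> \bar R}) : R :=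
  sup [set D | 0 <= D < d%:R /\ fourier_decay nu D].

(* Continuity uses the topology of 'rV[R]_d, as tuples carry none. *)
Definition row_of_tuple (t : Rd) : 'rV[R]_d := \row_i tnth t i.

(* mu, carried by [0,1]^d, is the weak limit of the measures rho m t dt on
   [0,1]^d. *)
Definition weak_limit (rho : nat -> Rd -> R)
    (mu : {finite_measure set Rd -> \bar R}) :=
  mu (~` unit_cube) = 0%E /\
  forall f : 'rV[R]_d -> R, {within row_of_tuple @` unit_cube, continuous f} ->
    \int[lebesgue_tuple R d]_(t in unit_cube) (f (row_of_tuple t) * rho m t)
      @[m --> \oo] --> \int[mu]_(t in unit_cube) f (row_of_tuple t).

End fourier.

Section cascade.
Context (R : realType) (d b : nat).

(* The cube with code h is prod_i [h_i / b^m, (h_i + 1) / b^m): codes are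
   0-based. *)
Definition cube_code (m : nat) := {ffun 'I_d -> 'I_(b ^ m)}.

Definition cube m (h : cube_code m) : set (d.-tuple R) :=
  [set t | forall i,
     (h i)%:R / (b ^ m)%:R <= tnth t i < (h i).+1%:R / (b ^ m)%:R].

(* All cubes of level >= 1: the pair (m, h) stands for level m + 1. *)
Definition cascade_index := {m : nat & cube_code m.+1}.

Context (T : Type) (W : cascade_index -> T -> R).

Definition level_weight (m : nat) (w : T) (t : d.-tuple R) : R :=
  match m with
  | 0%N => 1
  | k.+1 => \sum_(h : cube_code k.+1)
              W (existT (fun j => cube_code j.+1) k h) w * \1_(cube h) t
  end.

Definition cascade_density (w : T) (m : nat) (t : d.-tuple R) : R :=
  \prod_(j < m.+1) level_weight j w t.

End cascade.

Section iid.
Context (dO : measure_display) (Omega : measurableType dO) (R : realType).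
Variable P : probability Omega R.

Definition mutually_independent (I : eqType) (X : I -> {RV P >-> R}) :=
  forall (s : seq I) (B : I -> set R), uniq s -> (forall i, measurable (B i)) ->
    P (\bigcap_(i in [set` s]) (X i @^-1` B i)) =
    (\prod_(i <- s) P (X i @^-1` B i))%E.

Definition same_law (dQ : measure_display) (Omega' : measurableType dQ)
    (Q : probability Omega' R) (X : {RV P >-> R}) (Y : {RV Q >-> R}) :=
  forall B : set R, measurable B -> distribution P X B = distribution Q Y B.

End iid.

Definition logb (R : realType) (b : nat) (y : R) : R := ln y / ln b%:R.

(* Main.v *)
(* Replace the frequencies with |x| ~ b^k by a grid of mesh b^(-k) (a bounded
   measure has a Lipschitz Fourier transform), which has O(b^(2dk)) points, and
   let S_m be the vector of the values on the grid of the transform of the m-th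
   density. Revealing the weights one cube I at a time, S_m becomes a martingale
   with increments (W_I - 1) Q_I c_I, where Q_I is the product of the weights of
   the strict ancestors of I and c_I collects the integrals of the exponentials
   over I. In dimension N the function u |-> (sum |u_n|^q)^(p/q) with q even is
   p-smooth with a constant independent of N, so
     E |S_m|_q^p <= C N^(p/q) sum_j b^(jd) (E W^p)^j (sup_{I of level j} |c_I|)^p.
   Here |c_I| <= C b^(-jd) min(1, b^(j-k)) <= C b^(-jd) b^(s(j-k)) for 0 <= s <= 1,
   and the sum over j converges exactly when 2s is less than the exponent attached
   to p. For q large the factor N^(p/q) is a negligible power of b^k. Fatou's lemma
   and summation over k then bound the transform almost surely on all grids. *)

Require Import Defs.
From HB Require Import structures.
From mathcomp Require Import all_boot all_order all_algebra.
From mathcomp Require Import all_classical all_reals all_analysis.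
From mathcomp Require Import measurable_realfun complex ring lra.

Set Implicit Arguments.
Unset Strict Implicit.
Unset Printing Implicit Defensive.

Import Order.TTheory GRing.Theory Num.Theory.
Import numFieldNormedType.Exports.

Local Open Scope classical_set_scope.
Local Open Scope ring_scope.

(** * Independence *)

(** Only a moment of order p <= 2 is at hand, while the bound must hold at all grid points at once.
    For bounded q a fixed power of b^k would be lost to the cardinality of the grid; letting q grow
    while p stays put is possible because the constant of [lqp_smooth] does not see the dimension.
    No filtration and no conditional expectation occurs. A weight is independent of the
    sigma-algebra of all the others, and both the partial sum preceding it and its coefficient are
    measurable for that sigma-algebra, so a martingale step is Tonelli followed by the smoothness
    inequality with a centred increment. The cap 2 in the bound is the restriction s <= 1: when the
    frequency points along an axis, the integral of an exponential over a cube gains only one power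
    of it. Complex numbers stay out of the estimates: a sine is a cosine with shifted phase, so real
    and imaginary parts are two entries of the vector S_m. *)

Section independence.
Context (R : realType) (dO : measure_display) (Omega : measurableType dO).
Variable P : probability Omega R.
Context (I : eqType) (X : I -> {RV P >-> R}).
Hypothesis indepX : mutually_independent X.

(** The pi-system on which independence is assumed, restricted to the weights other than [X i]. *)
Definition cylinders_off (i : I) : set (set Omega) :=
  [set A | exists s (B : I -> set R), [/\ uniq s, i \notin s,
    forall j, measurable (B j) & A = \bigcap_(j in [set` s]) (X j @^-1` B j)]].

(** A second measurable structure on the same points: a function typed on [sigma_off i] and
    measurable there does not involve [X i]. The map [to_off] is the identity between the two
    structures. *)
Definition sigma_off (i : I) := g_sigma_algebraType (cylinders_off i).

Let measurable_preim j (B : set R) : measurable B -> measurable (X j @^-1` B).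
Proof. by move=> mB; rewrite -[X in measurable X]setTI; exact: measurable_funP. Qed.

Lemma setI_closed_cylinders_off i : setI_closed (cylinders_off i).
Proof.
move=> _ _ [s [B [us is_ mB ->]]] [s' [B' [us' is' mB' ->]]].
exists (undup (s ++ s')), (fun j =>
  (if j \in s then B j else setT) `&` (if j \in s' then B' j else setT)); split.
- exact: undup_uniq.
- by rewrite mem_undup mem_cat negb_or is_.
- by move=> j; apply: measurableI; case: ifP.
apply/seteqP; split=> w.
  move=> [h h'] j /=; rewrite mem_undup mem_cat => _.
  by split; case: ifP => // js; [exact: h|exact: h'].
move=> h; split=> j /= js.
  have : j \in undup (s ++ s') by rewrite mem_undup mem_cat js.
  by move/h => -[]; rewrite js.
have : j \in undup (s ++ s') by rewrite mem_undup mem_cat js orbT.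
by move/h => -[]; rewrite js.
Qed.

Lemma cylinders_off_measurable i A : cylinders_off i A -> measurable A.
Proof.
move=> [s [B [us is_ mB ->]]].
apply: fin_bigcap_measurable => [|j _]; first exact: finite_seq.
exact: measurable_preim.
Qed.

Lemma sigma_off_measurable i (A : set (sigma_off i)) :
  measurable A -> @measurable _ Omega A.
Proof.
move: A; apply: smallest_sub; first exact: sigma_algebra_measurable.
exact: cylinders_off_measurable.
Qed.

Definition to_off i (w : Omega) : sigma_off i := w.

Lemma measurable_to_off i : measurable_fun setT (to_off i).
Proof.
by move=> _ A mA; rewrite setTI; exact: (@sigma_off_measurable i A mA).
Qed.

Lemma measurable_sigma_off i j : j != i ->
  measurable_fun [set: sigma_off i] (X j : sigma_off i -> R).
Proof.
move=> ji _ B mB; rewrite setTI; apply: sub_sigma_algebra.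
exists [:: j], (fun=> B); split => //; first by rewrite inE eq_sym.
apply/seteqP; split=> w; last by apply; rewrite /= inE.
by move=> h k /=; rewrite inE => /eqP ->.
Qed.

HB.instance Definition _ i :=
  isMeasurableFun.Build _ _ Omega (sigma_off i) (to_off i) (@measurable_to_off i).

Definition restr_off i : probability (sigma_off i) R := distribution P (@to_off i).

Let indep_cylinder i (A : set R) (G : set Omega) : measurable A ->
  cylinders_off i G -> P (X i @^-1` A `&` G) = (P (X i @^-1` A) * P G)%E.
Proof.
move=> mA [s [B [us is_ mB ->]]].
pose B' j := if j == i then A else B j.
have mB' j : measurable (B' j) by rewrite /B'; case: ifP.
have sB' j : j \in s -> B' j = B j.
  by move=> js; rewrite /B'; case: eqP => // ji; rewrite ji (negbTE is_) in js.
have := indepX (s := i :: s) (B := B'); rewrite /= is_ us => /(_ isT mB').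
rewrite big_cons {2}/B' eqxx => E1.
have := indepX us mB => ->.
rewrite (eq_big_seq (fun j => P (X j @^-1` B' j))) -?E1; last first.
  by move=> j js /=; rewrite sB'.
congr (P _); apply/seteqP; split=> w.
  move=> [Aw Bw] j /=; rewrite inE => /orP[/eqP ->|js]; first by rewrite /B' eqxx.
  by rewrite sB'//; exact: Bw.
move=> h; split.
  by have := h i; rewrite /= inE eqxx /B' eqxx; exact.
by move=> j js /=; rewrite -sB'//; apply: h; rewrite /= inE js orbT.
Qed.

(** For fixed A both sides are finite measures in G; they agree on the cylinders, which are stable
    under intersection, hence on the sigma-algebra they generate. *)
Lemma indep_sigma_off i (A : set R) (G : set (sigma_off i)) : measurable A ->
  measurable G -> P (X i @^-1` A `&` G) = (P (X i @^-1` A) * P G)%E.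
Proof.
move=> mA mG.
have mXA := measurable_preim i mA.
have finA : P (X i @^-1` A) \is a fin_num by exact: fin_num_measure.
pose c : {nonneg R} := NngNum (fine_ge0 (measure_ge0 P (X i @^-1` A))).
pose m1 := mrestr P mXA.
pose m2 := mscale c P.
suff : pushforward m1 (@to_off i) G = pushforward m2 (@to_off i) G.
  by rewrite /pushforward /m1 /m2 /mrestr /mscale/= setIC fineK.
apply: (@measure_unique _ R (sigma_off i) (cylinders_off i) (fun=> setT)) => //.
- exact: setI_closed_cylinders_off.
- move=> _; exists [::], (fun=> setT); split => //.
  by apply/seteqP; split.
- by rewrite bigcup_const.
- move=> {mG}G cG; change (P (G `&` X i @^-1` A) = c%:num%:E * P G)%E.
  by rewrite setIC fineK// indep_cylinder.
- by move=> _; change (P (setT `&` X i @^-1` A) < +oo)%E; rewrite setTI ltey_eq finA.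
Qed.

End independence.

Section indep_integral.
Local Open Scope ereal_scope.
Context (R : realType) (dO : measure_display) (Omega : measurableType dO).
Variable P : probability Omega R.
Context (I : eqType) (X : I -> {RV P >-> R}).
Hypothesis indepX : mutually_independent X.
Context (dQ : measure_display) (Omega' : measurableType dQ).
Context (Q : probability Omega' R) (W : {RV Q >-> R}).
Hypothesis lawX : forall i, same_law (X i) W.

(** The substitute for conditioning: the pair ([X i], all other weights) has a product law, so
    Tonelli lets one weight be averaged with the rest frozen. *)
Lemma ge0_integral_indep i (F : R * sigma_off X i -> \bar R) :
  measurable_fun setT F -> (forall z, 0 <= F z) ->
  \int[P]_w F (X i w, w) = \int[P]_w \int[Q]_x F (W x, w).
Proof.
move=> mF F0.
pose J : Omega -> R * sigma_off X i := fun w => (X i w, w).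
have mJ : measurable_fun setT J.
  apply: measurable_fun_pair; [exact: measurable_funP|].
  exact: (@measurable_to_off _ _ _ P I X i).
pose J' : {mfun Omega >-> _} := HB.pack J (isMeasurableFun.Build _ _ _ _ J mJ).
have -> : \int[P]_w F (X i w, w) = \int[distribution P J']_z F z.
  by rewrite ge0_integral_distribution.
have E Z : measurable Z ->
    (distribution Q W \x restr_off X i) Z = distribution P J' Z.
  move: Z; apply: product_measure_unique => A B mA mB.
  by rewrite /= -(lawX i)// /distribution /pushforward/= -(indep_sigma_off indepX mA mB).
transitivity (\int[distribution Q W \x restr_off X i]_z F z).
  by apply: eq_measure_integral => Z mZ _; apply: (esym (E _ mZ)).
rewrite fubini_tonelli2// /fubini_G.
rewrite ge0_integral_distribution; last 2 first.
- exact: measurable_fun_fubini_tonelli_G.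
- by move=> y; apply: integral_ge0.
apply: eq_integral => w _ /=; rewrite ge0_integral_distribution//.
exact: measurableT_comp.
Qed.

Lemma measurable_integral_indep i (F : R * sigma_off X i -> \bar R) :
  measurable_fun setT F -> (forall z, 0 <= F z) ->
  measurable_fun [set: sigma_off X i] (fun w => \int[Q]_x F (W x, w)).
Proof.
move=> mF F0; rewrite (_ : (fun w => _) = fubini_G (distribution Q W) F).
  exact: measurable_fun_fubini_tonelli_G.
apply/funext => w; rewrite /fubini_G ge0_integral_distribution//.
exact: measurableT_comp.
Qed.

End indep_integral.

(** * Smoothness of the l^q norm *)

Section smoothness.
Context (R : realType).
Implicit Types (a b c r s p x : R) (q : nat).

(** With l = ln x, write x = e^(sl) e^((1-s)l) and use 1 + z <= e^z at z = (1-s)l and at z = -sl; in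
    the combination with weights s and 1-s the terms in l cancel. *)
Lemma powR_le_tangent s x : 0 < s <= 1 -> 0 <= x -> x `^ s <= 1 + s * (x - 1).
Proof.
move=> /andP[s0 s1]; rewrite le_eqVlt => /predU1P[<-|x0].
  by rewrite powR0 ?gt_eqF//; lra.
rewrite /powR gt_eqF//; set l := ln x.
have xE : x = expR (s * l) * expR ((1 - s) * l).
  by rewrite -expRD -mulrDl addrC subrK mul1r lnK.
have h1 := expR_ge1Dx ((1 - s) * l).
have h2 := expR_ge1Dx (- (s * l)).
have e0 := expR_gt0 (s * l).
have h3 : expR (s * l) * expR (- (s * l)) = 1 by rewrite -expRD subrr expR0.
have h4 : s * (expR (s * l) * (1 + (1 - s) * l)) <= s * x.
  by rewrite [in leRHS]xE ler_pM2l// ler_pM2l.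
have h5 : (1 - s) * (expR (s * l) * (1 - s * l)) <= 1 - s.
  rewrite -[leRHS]mulr1 ler_wpM2l ?subr_ge0// -[leRHS]h3 ler_pM2l//.
lra.
Qed.

Lemma exprMn_le_add q i a c : (i <= q)%N -> 0 <= a -> 0 <= c ->
  a ^+ (q - i) * c ^+ i <= a ^+ q + c ^+ q.
Proof.
move=> iq a0 c0; have [ac|ca] := leP a c.
  rewrite (le_trans (y := c ^+ q))//; last by rewrite lerDr exprn_ge0.
  by rewrite -[in leRHS](subnK iq) exprD ler_wpM2r ?exprn_ge0// lerXn2r.
rewrite (le_trans (y := a ^+ q))//; last by rewrite lerDl exprn_ge0.
by rewrite -[in leRHS](subnK iq) exprD ler_wpM2l ?exprn_ge0// lerXn2r// ltW.
Qed.

(** The first two binomial terms are kept. After b^2 is factored out, [exprMn_le_add] bounds each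
    later monomial by the two extreme ones, and the binomial coefficients sum to 2^q. *)
Lemma exprDn_even_le q a b : ~~ odd q -> (2 <= q)%N ->
  (a + b) ^+ q <= a ^+ q + q%:R * a ^+ q.-1 * b
                + 2 ^+ q * (a ^+ (q - 2) * b ^+ 2 + b ^+ q).
Proof.
case: q => [|[|k]]// evk _; rewrite exprDn.
rewrite big_ord_recl big_ord_recl /= subn0 bin0 mulr1n expr0 mulr1.
rewrite /bump /= addn0 bin1 expr1 subn1 subn2 /=.
have -> : a ^+ k.+1 * b *+ k.+2 = k.+2%:R * a ^+ k.+1 * b.
  by rewrite -mulr_natl mulrA.
rewrite addrA lerD2l.
have bE : 0 <= a ^+ k * b ^+ 2 + b ^+ k.+2.
  have ek : ~~ odd k by move: evk; rewrite /= negbK.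
  by apply: addr_ge0; [apply: mulr_ge0; [exact: exprn_even_ge0|exact: sqr_ge0]|exact: exprn_even_ge0].
have -> : (2 ^+ k.+2 : R) = \sum_(i < k.+3) ('C(k.+2, i))%:R.
  rewrite -natrX.
  by rewrite -[2%N]/(1 + 1)%N expnDn natr_sum; apply: eq_bigr => i _;
    rewrite !exp1n !muln1.
rewrite mulr_suml [leRHS]big_ord_recl [X in _ <= _ + X]big_ord_recl/=.
apply: (@le_trans _ _ (\sum_(i < k.+1) 'C(k.+2, bump 0 (bump 0 i))%:R * (a ^+ k * b ^+ 2 + b ^+ k.+2))); last first.
  by rewrite addrA lerDr addr_ge0// mulr_ge0.
apply: ler_sum => -[i ik] _; rewrite -[leLHS]mulr_natl.
rewrite ler_wpM2l// (le_trans (ler_norm _))// normrM !normrX.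
have ek : ~~ odd k by move: evk; rewrite /= negbK.
have Ea : a ^+ k = `|a| ^+ k by rewrite -normrX ger0_norm// exprn_even_ge0.
have Eb : b ^+ k.+2 = `|b| ^+ k * `|b| ^+ 2.
  by rewrite -exprD addn2 -normrX ger0_norm// exprn_even_ge0.
rewrite Eb Ea -[b ^+ 2](real_normK (num_real _)) -mulrDl.
rewrite !add1n /= !subSS -(addn2 i) exprD mulrA ler_wpM2r ?sqr_ge0//.
exact: exprMn_le_add.
Qed.

Lemma even_expr_norm q a : ~~ odd q -> a ^+ q = `|a| ^+ q.
Proof. by move=> eq; rewrite -normrX ger0_norm// exprn_even_ge0. Qed.

Lemma exprDn_even_le_add q a b : ~~ odd q -> (a + b) ^+ q <= 2 ^+ q * (a ^+ q + b ^+ q).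
Proof.
move=> eq; rewrite (even_expr_norm a eq) (even_expr_norm b eq) (even_expr_norm (a + b) eq).
have h : `|a + b| <= 2 * Num.max `|a| `|b|.
  have := ler_normD a b.
  have : `|a| <= Num.max `|a| `|b| by rewrite le_max lexx.
  have : `|b| <= Num.max `|a| `|b| by rewrite le_max lexx orbT.
  lra.
apply: (le_trans (lerXn2r _ _ _ h)); rewrite ?nnegrE ?mulr_ge0 ?le_max ?normr_ge0//.
rewrite exprMn ler_pM2l ?exprn_gt0//.
by case: (leP `|a| `|b|) => _; rewrite ?lerDr ?lerDl exprn_ge0.
Qed.


(** The p-th power of the l^q norm; it is meant for even q, where no absolute values are
    required. *)
Definition lqp (N : finType) q p (u : N -> R) : R :=
  (\sum_n u n ^+ q) `^ (p / q%:R).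

Lemma lqp_ge0 (N : finType) q p (u : N -> R) : 0 <= lqp q p u.
Proof. exact: powR_ge0. Qed.

Lemma lqp_scale (N : finType) q p x (u : N -> R) : ~~ odd q -> (2 <= q)%N ->
  lqp q p (fun n => x * u n) = `|x| `^ p * lqp q p u.
Proof.
move=> eq q2; rewrite /lqp; under eq_bigr do rewrite exprMn.
rewrite -mulr_sumr powRM ?sumr_ge0//; last 2 first.
- exact: exprn_even_ge0.
- by move=> i _; exact: exprn_even_ge0.
rewrite (even_expr_norm _ eq) -powR_mulrn// -powRrM mulrCA divff ?mulr1//.
by rewrite pnatr_eq0 -lt0n (leq_trans _ q2).
Qed.

(* The difference between the two sides of the tangent estimate is controlled
   by comparing [A = sum u^q] with [B = sum v^q] through the scale
   [r = (B / A)^(1/q)]: every mixed term is homogeneous in [(u, v / r)]. *)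
Lemma lqp_smooth q p : ~~ odd q -> (2 <= q)%N -> 1 < p <= 2 ->
  forall (N : finType) (u v : N -> R),
  lqp q p (fun n => u n + v n) <= lqp q p u
    + p * (\sum_n u n ^+ q) `^ (p / q%:R - 1) * (\sum_n u n ^+ q.-1 * v n)
    + (4 * 2 ^+ q + 4) * lqp q p v.
Proof.
move=> eq q2 /andP[p1 p2] N u v.
have q0 : (0 < q)%N by rewrite (leq_trans _ q2).
have q0R : 0 < q%:R :> R by rewrite ltr0n.
rewrite /lqp; set s := p / q%:R.
have s0 : 0 < s by rewrite divr_gt0//; lra.
have s1 : s <= 1.
  by rewrite ler_pdivrMr// mul1r (le_trans p2)// (ler_nat R 2).
have pE : p = s * q%:R by rewrite divfK// gt_eqF.
set A := \sum_n u n ^+ q; set B := \sum_n v n ^+ q.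
set T := \sum_n (u n + v n) ^+ q; set X := \sum_n u n ^+ q.-1 * v n.
have E0 (w : N -> R) n : 0 <= w n ^+ q by exact: exprn_even_ge0.
have A0 : 0 <= A by exact: sumr_ge0.
have B0 : 0 <= B by exact: sumr_ge0.
have T0 : 0 <= T by apply: sumr_ge0 => n _; exact: exprn_even_ge0.
have C0 : 1 <= 2 ^+ q :> R by rewrite exprn_ege1// ler1n.
have sum0 (w : N -> R) : \sum_n w n ^+ q = 0 -> forall n, w n = 0.
  move=> /eqP; rewrite psumr_eq0// => /allP h n.
  by have := h n (mem_index_enum _); rewrite expf_eq0 q0 => /eqP.
have [B00|Bn0] := eqVneq B 0.
  have v0 := sum0 _ B00; have -> : T = A by apply: eq_bigr => n _; rewrite v0 addr0.
  have -> : X = 0 by rewrite /X big1// => n _; rewrite v0 mulr0.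
  by rewrite mulr0 addr0 lerDl mulr_ge0 ?powR_ge0//; lra.
have Bp : 0 < B by rewrite lt_neqAle eq_sym Bn0.
have [A00|An0] := eqVneq A 0.
  have u0 := sum0 _ A00; have -> : T = B by apply: eq_bigr => n _; rewrite u0 add0r.
  have -> : X = 0.
    rewrite /X big1// => n _.
    by rewrite u0 expr0n -subn1 subn_eq0 leqNgt q2 mul0r.
  rewrite mulr0 addr0 A00 powR0 ?gt_eqF// add0r ler_peMl ?powR_ge0//.
  lra.
have Ap : 0 < A by rewrite lt_neqAle eq_sym An0.
pose r := (B / A) `^ q%:R^-1.
have BA : 0 < B / A by rewrite divr_gt0.
have rp : 0 < r by rewrite powR_gt0.
have r0 := ltW rp; have BA0 := ltW BA.
have rq : r ^+ q = B / A.
  by rewrite -powR_mulrn // -powRrM mulVf ?gt_eqF// powRr1.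
have rpE : A `^ s * r `^ p = B `^ s.
  by rewrite -powRrM mulrC [X in _ `^ X * _]mulrC -/s -powRM// divfK.
pose c n : R := `|v n| / r.
have c0 n : 0 <= c n by rewrite divr_ge0.
have cE n : `|v n| = r * c n by rewrite mulrCA divff ?mulr1// gt_eqF.
have cB : \sum_n c n ^+ q = A.
  under eq_bigr do rewrite expr_div_n -even_expr_norm// rq.
  by rewrite -mulr_suml -/B invf_div mulrCA divff ?mulr1.
(* By [exprMn_le_add] every mixed monomial in |u| and c is below |u|^q + c^q, so this one sum serves
   the linear and the quadratic term. *)
have uc : \sum_n (`|u n| ^+ q + c n ^+ q) = 2 * A.
  by rewrite big_split/= cB; under eq_bigr do rewrite -even_expr_norm//; rewrite -/A; lra.
have XA : `|X| <= r * (2 * A).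
  rewrite (le_trans (ler_norm_sum _ _ _))// -uc mulr_sumr ler_sum// => n _.
  rewrite normrM normrX cE mulrCA ler_pM2l//.
  have := exprMn_le_add (i := 1) q0 (normr_ge0 (u n)) (c0 n).
  by rewrite expr1 subn1.
have pX : p * A `^ (s - 1) * X = A `^ s * (s * (q%:R * (X / A))).
  rewrite powRB ?An0 ?implybT// powRr1// pE; field; exact: An0.
rewrite pX.
have As0 : 0 < A `^ s by rewrite powR_gt0.
have Ase := ltW As0.
have C1 : 0 < 2 ^+ q :> R by exact: lt_le_trans C0.
have Cge := ltW C1.
have sq2 : s * q%:R <= 2 by rewrite -pE.
(* If v is the smaller vector then r <= 1, and the second-order error A^s r^2 is at most A^s r^p =
   B^s because p <= 2; the tangent of the power s at T/A then gives the claim. *)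
have [BleA|AltB] := leP B A.
  have r1 : r <= 1.
    have : (B / A) `^ q%:R^-1 <= 1 `^ q%:R^-1.
      by apply: ge0_ler_powR; rewrite ?nnegrE ?invr_ge0 ?(ltW BA) ?ler01 ?(ltW q0R)// ler_pdivrMr// mul1r.
    by rewrite powR1.
  have r2 : A `^ s * r ^+ 2 <= B `^ s.
    rewrite -rpE ler_pM2l// -powR_mulrn//.
    by apply: ger_powR => //; rewrite rp r1.
  have TA : T <= A + q%:R * X + 2 ^+ q * (3 * A * r ^+ 2).
    have -> : A + q%:R * X = \sum_n (u n ^+ q + q%:R * u n ^+ q.-1 * v n).
      rewrite big_split/= -/A; congr (_ + _).
      by rewrite mulr_sumr; apply: eq_bigr => n _; rewrite mulrA.
    have : \sum_n (u n ^+ (q - 2) * v n ^+ 2 + v n ^+ q) <= 3 * A * r ^+ 2.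
      rewrite big_split/= -/B.
      have : \sum_n u n ^+ (q - 2) * v n ^+ 2 <= r ^+ 2 * (2 * A).
        rewrite -uc mulr_sumr ler_sum// => n _.
        rewrite -(real_normK (num_real (v n))) cE exprMn mulrCA ler_pM2l ?exprn_gt0//.
        rewrite (even_expr_norm _ (_ : ~~ odd (q - 2))) ?exprMn_le_add//.
        by rewrite oddB//= addbF.
      have : B <= A * r ^+ 2.
        have -> : B = A * r ^+ q by rewrite rq mulrCA divff ?mulr1.
        by rewrite ler_pM2l// ler_wiXn2l.
      lra.
    move=> h; rewrite -(ler_pM2l C1) in h.
    apply: le_trans (lerD (lexx _) h); rewrite mulr_sumr -big_split/= ler_sum// => n _.
    exact: exprDn_even_le.
  have := @powR_le_tangent s (T / A); rewrite s0 s1 => /(_ isT (divr_ge0 T0 A0)).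
  rewrite -(ler_pM2l As0) -powRM ?divr_ge0// mulrCA divff// mulr1 => h.
  apply: (le_trans h).
  have TA' : T / A - 1 <= q%:R * (X / A) + 3 * 2 ^+ q * r ^+ 2.
    rewrite lerBlDr ler_pdivrMr//; apply: (le_trans TA).
    by rewrite le_eqVlt; apply/orP; left; apply/eqP; field.
  rewrite -addrA (le_trans (y := A `^ s * (1 + s * (q%:R * (X / A) + 3 * 2 ^+ q * r ^+ 2))))//.
    by rewrite ler_pM2l// lerD2l ler_pM2l.
  have h2 : s * (A `^ s * r ^+ 2 * (3 * 2 ^+ q)) <= B `^ s * (3 * 2 ^+ q).
    apply: (@le_trans _ _ (A `^ s * r ^+ 2 * (3 * 2 ^+ q))).
      by apply: ler_piMl => //; rewrite !mulr_ge0// exprn_ge0.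
    by rewrite ler_pM2r// mulr_gt0.
  have := powR_ge0 B s; have : 0 <= B `^ s * 2 ^+ q by rewrite mulr_ge0 ?powR_ge0//; lra.
  lra.
(* If v is the larger vector no cancellation is used: T^s is itself O(B^s), and the linear term, of
   size A^s r, is at most A^s r^p = B^s because p >= 1. *)
have r1 : 1 <= r.
  have : 1 `^ q%:R^-1 <= (B / A) `^ q%:R^-1.
    by apply: ge0_ler_powR; rewrite ?nnegrE ?invr_ge0 ?(ltW BA) ?ler01 ?(ltW q0R)// ler_pdivlMr// mul1r ltW.
  by rewrite powR1.
have r2 : A `^ s * r <= B `^ s.
  by rewrite -rpE ler_pM2l// -[leLHS]powRr1// ler_powR// ltW.
have TB : T <= 2 ^+ q * (2 * B).
  have : \sum_n (u n ^+ q + v n ^+ q) <= 2 * B by rewrite big_split/= -/A -/B; lra.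
  move=> h; rewrite -(ler_pM2l C1) in h.
  apply: le_trans h; rewrite mulr_sumr ler_sum// => n _; exact: exprDn_even_le_add.
have TBs : T `^ s <= 2 ^+ q * 2 * B `^ s.
  apply: (@le_trans _ _ ((2 ^+ q * 2 * B) `^ s)).
    by apply: ge0_ler_powR; rewrite ?nnegrE ?(ltW s0) ?mulr_ge0// -mulrA.
  rewrite powRM ?mulr_ge0// ler_pM2r ?powR_gt0//.
  by rewrite -[leRHS]powRr1 ?mulr_ge0// ler_powR//; lra.
have XB : - (A `^ s * (s * (q%:R * (X / A)))) <= 4 * B `^ s.
  have h : - (X / A) <= 2 * r.
    rewrite -mulNr ler_pdivrMr//.
    by have := ler_norm (- X); rewrite normrN; lra.
  have -> : - (A `^ s * (s * (q%:R * (X / A)))) = A `^ s * (s * q%:R) * (- (X / A)).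
    by ring.
  apply: (@le_trans _ _ (A `^ s * (s * q%:R) * (2 * r))).
    by apply: ler_wpM2l => //; apply: mulr_ge0 => //; rewrite -pE; lra.
  have : A `^ s * r * (s * q%:R) <= A `^ s * r * 2 by rewrite ler_wpM2l// mulr_ge0.
  lra.
have : 0 <= B `^ s by exact: powR_ge0.
have : 2 ^+ q * B `^ s >= 0 by rewrite mulr_ge0 ?powR_ge0//; lra.
lra.
Qed.

End smoothness.

(** * Moments of weighted martingales *)

Section moment.
Local Open Scope ereal_scope.
Context (R : realType) (dO : measure_display) (Omega : measurableType dO).
Variable P : probability Omega R.
Context (I : eqType) (X : I -> {RV P >-> R}).
Hypothesis indepX : mutually_independent X.
Context (dQ : measure_display) (Omega' : measurableType dQ).
Context (Q : probability Omega' R) (W : {RV Q >-> R}).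
Hypothesis lawX : forall i, same_law (X i) W.
Variables (p : R) (q : nat).
Hypotheses (qeven : ~~ odd q) (q2 : (2 <= q)%N) (p12 : (1 < p <= 2)%R).
Hypothesis EW1 : 'E_Q[W] = 1.
Variable a : R.
Hypothesis EWp : \int[Q]_x (`|W x| `^ p)%:E = a%:E.

Lemma measurable_lqp d (T : measurableType d) (N : finType) (u : N -> T -> R) :
  (forall n, measurable_fun setT (u n)) ->
  measurable_fun setT (fun w => lqp q p (u ^~ w)).
Proof.
move=> mu; apply: (measurableT_comp (measurable_powR (p / q%:R)%R)).
by apply: measurable_sum => n; exact: measurable_funX.
Qed.

Let mW : measurable_fun setT (W : Omega' -> R). Proof. exact: measurable_funP. Qed.

Let p0 : (0 <= p)%R. Proof. by move: p12 => /andP[? ?]; lra. Qed.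

Let iWp : Q.-integrable setT (fun x => (`|W x| `^ p)%:E).
Proof.
apply/integrableP; split.
  apply/measurable_EFinP/(measurableT_comp (measurable_powR p)).
  exact: measurableT_comp.
rewrite (eq_integral (fun x => (`|W x| `^ p)%:E)) ?EWp ?ltry// => x _.
by rewrite gee0_abs// lee_fin powR_ge0.
Qed.

Let iW : Q.-integrable setT (fun x => (W x)%:E).
Proof.
apply: (@le_integrable _ _ _ _ _ _ _ (fun x => 1 + (`|W x| `^ p)%:E)) => //.
- exact/measurable_EFinP.
- move=> x _; rewrite -EFinD !abse_EFin lee_fin.
  rewrite [leRHS]ger0_norm ?addr_ge0 ?powR_ge0//.
  have [W1|/ltW W1] := leP `|W x|%R 1%R.
    by rewrite (le_trans W1)// lerDl powR_ge0.
  apply: (@le_trans _ _ (`|W x| `^ p)%R); last by rewrite lerDr.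
  by apply: le1r_powR => //; case/andP: p12 => /ltW.
- by apply: integrableD => //; exact: finite_measure_integrable_cst.
Qed.

Let iW1 : Q.-integrable setT (fun x => (W x - 1)%:E).
Proof.
under eq_fun do rewrite EFinB.
by apply: integrableB => //; exact: finite_measure_integrable_cst.
Qed.

Let integral_cstQ (r : R) : \int[Q]_x r%:E = r%:E.
Proof. by have := expectation_cst Q r; rewrite unlock. Qed.

Let EW1_0 : \int[Q]_x (W x - 1)%:E = 0.
Proof.
under eq_integral do rewrite EFinB.
rewrite integralB//; last exact: finite_measure_integrable_cst.
by rewrite -expectation_def EW1 integral_cstQ subee.
Qed.

Let mW1p : measurable_fun setT (fun x => (`|W x - 1| `^ p)%R).
Proof.
apply: (measurableT_comp (measurable_powR p)).
by apply: measurableT_comp => //; exact: measurable_funB.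
Qed.

Let iW1p : Q.-integrable setT (fun x => (`|W x - 1| `^ p)%:E).
Proof.
apply: (@le_integrable _ _ _ _ _ _ _ (fun x => (2 `^ p)%:E * (1 + (`|W x| `^ p)%:E))) => //.
- exact/measurable_EFinP.
- move=> x _; rewrite -EFinD -EFinM !abse_EFin lee_fin.
  rewrite [leRHS]ger0_norm ?mulr_ge0 ?addr_ge0 ?powR_ge0//.
  rewrite ger0_norm ?powR_ge0//.
  have h : (`|W x - 1| <= 2 * Num.max 1 `|W x|)%R.
    have := ler_normB (W x) (1%R : R); rewrite normr1.
    have : (`|W x| <= Num.max 1 `|W x|)%R by rewrite le_max lexx orbT.
    have : (1 <= Num.max 1 `|W x|)%R by rewrite le_max lexx.
    lra.
  apply: (@le_trans _ _ ((2 * Num.max 1 `|W x|) `^ p)%R).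
    by apply: ge0_ler_powR; rewrite ?nnegrE ?mulr_ge0 ?le_max ?ler01.
  rewrite powRM ?le_max ?ler01// ler_wpM2l ?powR_ge0//.
  by case: (leP 1%R `|W x|%R) => _; rewrite ?powR1 ?lerDl ?lerDr// powR_ge0.
- apply: integrableZl => //; apply: integrableD => //.
  exact: finite_measure_integrable_cst.
Qed.

(** The constant of [lqp_smooth] times the p-th moment of the centred weight. It depends on q but
    not on the number of frequencies. *)
Definition smooth_cst : R :=
  ((4 * 2 ^+ q + 4) * fine (\int[Q]_x (`|W x - 1| `^ p)%:E))%R.

Lemma smooth_cst_ge0 : (0 <= smooth_cst)%R.
Proof.
apply: mulr_ge0; first by apply: addr_ge0 => //; apply: mulr_ge0 => //; exact: exprn_ge0.
by apply: fine_ge0; apply: integral_ge0 => x _; rewrite lee_fin powR_ge0.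
Qed.

(** One martingale step with the past frozen: the linear term of [lqp_smooth] integrates to 0 since
    W - 1 is centred, leaving a cost of order p in v. *)
Let inner (N : finType) (u v : N -> R) :
  \int[Q]_x (lqp q p (fun n => u n + (W x - 1) * v n)%R)%:E <=
  (lqp q p u + smooth_cst * lqp q p v)%:E.
Proof.
pose l := (p * (\sum_n u n ^+ q) `^ (p / q%:R - 1) * (\sum_n u n ^+ q.-1 * v n))%R.
pose C := (4 * 2 ^+ q + 4)%R : R.
have il : Q.-integrable setT (fun x => l%:E * (W x - 1)%:E).
  by apply: integrableZl.
have iC : Q.-integrable setT (fun x => (C * lqp q p v)%:E * (`|W x - 1| `^ p)%:E).
  by apply: integrableZl.
apply: (@le_trans _ _ (\int[Q]_x ((lqp q p u)%:E + (l%:E * (W x - 1)%:E +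
    (C * lqp q p v)%:E * (`|W x - 1| `^ p)%:E)))).
  have mid : forall x, (lqp q p (fun n => u n + (W x - 1) * v n))%:E <=
      (lqp q p u)%:E + (l%:E * (W x - 1)%:E +
    (C * lqp q p v)%:E * (`|W x - 1| `^ p)%:E).
    move=> x; rewrite -!EFinM -!EFinD lee_fin.
    have := lqp_smooth qeven q2 p12 u (fun n => (W x - 1) * v n)%R.
    rewrite lqp_scale//.
    have -> : (\sum_n u n ^+ q.-1 * ((W x - 1) * v n) = (W x - 1) * \sum_n u n ^+ q.-1 * v n)%R.
      by rewrite mulr_sumr; apply: eq_bigr => n _; rewrite mulrCA.
    rewrite -/C /l => h; apply: (le_trans h); rewrite le_eqVlt; apply/orP; left; apply/eqP; ring.
  apply: ge0_le_integral => //.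
  - by move=> x _; rewrite lee_fin lqp_ge0.
  - apply/measurable_EFinP; apply: (@measurable_lqp _ _ _ (fun n x => u n + (W x - 1) * v n)%R) => n.
    by apply: measurable_funD => //; apply: measurable_funM => //; exact: measurable_funB.
  - by apply: emeasurable_funD => //; apply: emeasurable_funD;
      apply: emeasurable_funM => //; [case/integrableP: iW1|case/integrableP: iW1p].
rewrite integralD//; last 2 first.
- exact: finite_measure_integrable_cst.
- by apply: integrableD.
rewrite integral_cstQ integralD//.
rewrite !integralZl// EW1_0 mule0 add0e EFinD leeD2l//.
rewrite /smooth_cst -/C -[X in _ * X](@fineK R) ?integrable_fin_num//.
by rewrite -EFinM lee_fin mulrAC.
Qed.

(** Neither u nor v involves [X i], so [ge0_integral_indep] replaces that weight by an independent
    copy of W and [inner] applies for each fixed w. *)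
Lemma lqp_step (N : finType) i (u v : N -> Omega -> R) :
  (forall n, measurable_fun [set: sigma_off X i] (u n : sigma_off X i -> R)) ->
  (forall n, measurable_fun [set: sigma_off X i] (v n : sigma_off X i -> R)) ->
  \int[P]_w (lqp q p (fun n => u n w + (X i w - 1) * v n w)%R)%:E <=
  \int[P]_w (lqp q p (u ^~ w))%:E + smooth_cst%:E * \int[P]_w (lqp q p (v ^~ w))%:E.
Proof.
move=> mu mv.
have mO d (T : measurableType d) (f : Omega -> T) :
    measurable_fun [set: sigma_off X i] (f : sigma_off X i -> T) -> measurable_fun setT f.
  by move=> mf; exact: (measurableT_comp mf (@measurable_to_off _ _ _ P I X i)).
have muO n := mO _ _ _ (mu n); have mvO n := mO _ _ _ (mv n).
pose F (z : R * sigma_off X i) : \bar R :=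
  (lqp q p (fun n => u n z.2 + (z.1 - 1) * v n z.2)%R)%:E.
have mF : measurable_fun setT F.
  apply/measurable_EFinP.
  apply: (@measurable_lqp _ _ _ (fun n (z : R * sigma_off X i) => u n z.2 + (z.1 - 1) * v n z.2)%R) => n.
  apply: measurable_funD; first exact: measurableT_comp.
  apply: measurable_funM; last exact: measurableT_comp.
  exact: measurable_funB.
rewrite (ge0_integral_indep indepX lawX mF)//; last first.
  by move=> z; rewrite lee_fin lqp_ge0.
rewrite -ge0_integralZl_EFin//; last 3 first.
- by move=> w _; rewrite lee_fin lqp_ge0.
- by apply/measurable_EFinP; exact: measurable_lqp.
- exact: smooth_cst_ge0.
rewrite -ge0_integralD//; last 4 first.
- by move=> w _; rewrite lee_fin lqp_ge0.
- by apply/measurable_EFinP; exact: measurable_lqp.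
- by move=> w _; rewrite -EFinM lee_fin mulr_ge0 ?lqp_ge0// smooth_cst_ge0.
- apply: emeasurable_funM => //; apply/measurable_EFinP; exact: measurable_lqp.
apply: ge0_le_integral => //.
- by move=> w _; apply: integral_ge0 => x _; rewrite lee_fin lqp_ge0.
- apply: (mO _ (\bar R) (fun w => \int[Q]_x F (W x, w))).
  by apply: measurable_integral_indep => // z; rewrite lee_fin lqp_ge0.
- apply: emeasurable_funD; first by apply/measurable_EFinP; exact: measurable_lqp.
  by apply: emeasurable_funM => //; apply/measurable_EFinP; exact: measurable_lqp.
- by move=> w _; rewrite -EFinM -EFinD /F /=; exact: (inner (u ^~ w) (v ^~ w)).
Qed.

(** Adds the increments of one level cube by cube. Since i does not occur in the tail of the list,
    the partial sum over that tail is part of the past of [X i]. *)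
Lemma lqp_increments (N : finType) (r : seq I) (u : N -> Omega -> R)
    (v : I -> N -> Omega -> R) : uniq r ->
  (forall j n, j \in r ->
    measurable_fun [set: sigma_off X j] (u n : sigma_off X j -> R)) ->
  (forall i j n, i \in r -> j \in r ->
    measurable_fun [set: sigma_off X j] (v i n : sigma_off X j -> R)) ->
  \int[P]_w (lqp q p (fun n => u n w + \sum_(i <- r) (X i w - 1) * v i n w)%R)%:E <=
  \int[P]_w (lqp q p (u ^~ w))%:E
    + smooth_cst%:E * \sum_(i <- r) \int[P]_w (lqp q p (v i ^~ w))%:E.
Proof.
elim: r => [_ _ _|i r IH /= /andP[ir ur] mu mv].
  rewrite big_nil mule0 adde0 le_eqVlt; apply/orP; left; apply/eqP.
  apply: eq_integral => w _; congr (lqp _ _ _)%:E; apply/funext => n.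
  by rewrite big_nil addr0.
pose u' n w := (u n w + \sum_(i <- r) (X i w - 1) * v i n w)%R.
have mu' n : measurable_fun [set: sigma_off X i] (u' n : sigma_off X i -> R).
  apply: measurable_funD; first by apply: mu; rewrite inE eqxx.
  (* [measurable_sum] asks for every index j, while measurability is known only for j in r; the test
     makes the other summands 0. *)
  have : measurable_fun [set: sigma_off X i] ((fun w => \sum_(j <- r)
      (if j \in r then (X j w - 1) * v j n w else 0))%R : sigma_off X i -> R).
    apply: measurable_sum => j; have [jr|_] := boolP (j \in r) => //.
    apply: measurable_funM; last by apply: mv; rewrite inE ?eqxx// jr orbT.
    apply: measurable_funB => //; apply: measurable_sigma_off.
    by apply: contraNneq ir => <-.
  by apply: eq_measurable_fun => w _; apply: eq_big_seq => j ->.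
rewrite (eq_integral (fun w =>
    (lqp q p (fun n => u' n w + (X i w - 1) * v i n w)%R)%:E)); last first.
  move=> w _; congr (lqp _ _ _)%:E; apply/funext => n.
  by rewrite big_cons /u' [in RHS]addrAC addrA.
apply: (le_trans (lqp_step mu' _)).
  by move=> n; apply: mv; rewrite inE eqxx.
rewrite big_cons [X in _ <= _ + X]ge0_muleDr; last 2 first.
- by apply: integral_ge0 => w _; rewrite lee_fin lqp_ge0.
- by apply: sume_ge0 => j _; apply: integral_ge0 => w _; rewrite lee_fin lqp_ge0.
rewrite [X in _ <= _ + X]addeC addeA; apply: leeD2r; apply: IH => //.
- by move=> j n jr; apply: mu; rewrite inE jr orbT.
- by move=> j k n jr kr; apply: mv; rewrite inE ?jr ?kr orbT.
Qed.

Lemma weight_moment_step i (Z : Omega -> R) :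
  measurable_fun [set: sigma_off X i] (Z : sigma_off X i -> R) ->
  \int[P]_w (`|Z w * X i w| `^ p)%:E = a%:E * \int[P]_w (`|Z w| `^ p)%:E.
Proof.
move=> mZ.
pose F (z : R * sigma_off X i) : \bar R := (`|Z z.2 * z.1| `^ p)%:E.
have mF : measurable_fun setT F.
  apply/measurable_EFinP; apply: (measurableT_comp (measurable_powR p)).
  apply: measurableT_comp => //; apply: measurable_funM => //.
  exact: measurableT_comp.
have F0 z : 0 <= F z by rewrite lee_fin powR_ge0.
rewrite (ge0_integral_indep indepX lawX mF F0).
have a0 : (0 <= a)%R.
  by rewrite -lee_fin -EWp; apply: integral_ge0 => x _; rewrite lee_fin powR_ge0.
rewrite -ge0_integralZl_EFin//; last first.
  apply/measurable_EFinP; apply: (measurableT_comp (measurable_powR p)).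
  apply: measurableT_comp => //.
  exact: (measurableT_comp mZ (@measurable_to_off _ _ _ P I X i)).
apply: eq_integral => w _; rewrite -EWp muleC -ge0_integralZl_EFin ?powR_ge0//.
- by apply: eq_integral => x _; rewrite /F /= normrM powRM// EFinM.
- by case/integrableP: iWp.
Qed.

End moment.

(** * Trigonometric integrals over boxes *)

Section trigonometric_bounds.
Context (R : realType).
Implicit Types a x y u v : R.

Lemma sin_lipschitz x y : `|sin x - sin y| <= `|x - y|.
Proof.
wlog xy : x y / y <= x => [h|].
  have [|/ltW] := leP y x; first exact: h.
  by move=> /h; rewrite distrC [leRHS]distrC.
have [|c _ ->] := @MVT_segment R sin cos y x xy; last first.
  by rewrite normrM ler_piMl// cos_max.
exact/continuous_subspaceT/continuous_sin.
Qed.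

Lemma cos_lipschitz x y : `|cos x - cos y| <= `|x - y|.
Proof.
rewrite -!sinDpihalf; apply: (le_trans (sin_lipschitz _ _)).
by rewrite opprD addrACA subrr addr0.
Qed.

Lemma sin_le_norm x : `|sin x| <= `|x|.
Proof. by have := sin_lipschitz x 0; rewrite sin0 !subr0. Qed.

(** The integral of cos(a + xt) over [u, v] is this factor times the cosine at the midpoint. The
    factor is free of the phase a, so the factors of different coordinates multiply; at x = 0 it is
    the limiting value. *)
Definition trig_factor x u v : R :=
  if x == 0 then v - u else 2 / x * sin (x * (v - u) / 2).

Lemma trig_factor_le_len x u v : u <= v -> `|trig_factor x u v| <= v - u.
Proof.
move=> uv; have uv0 : 0 <= v - u by rewrite subr_ge0.
rewrite /trig_factor; case: eqP => [_|/eqP x0]; first by rewrite ger0_norm.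
rewrite normrM (le_trans (ler_wpM2l _ (sin_le_norm _)))//.
rewrite -normrM (_ : 2 / x * (x * (v - u) / 2) = v - u) ?ger0_norm//.
by field.
Qed.

Lemma trig_factor_le_inv x u v : x != 0 -> `|trig_factor x u v| <= 2 / `|x|.
Proof.
move=> x0; rewrite /trig_factor (negbTE x0) normrM normrM normfV.
by rewrite ger0_norm// ler_piMr ?sin_max// divr_ge0.
Qed.

Lemma trig_factorE a x u v : x != 0 ->
  (sin (a + x * v) - sin (a + x * u)) / x = trig_factor x u v * cos (a + x * ((u + v) / 2)).
Proof.
move=> x0; rewrite /trig_factor (negbTE x0).
set c := a + x * ((u + v) / 2); set e := x * (v - u) / 2.
have -> : a + x * v = c + e by rewrite /c /e; field.
have -> : a + x * u = c + - e by rewrite /c /e; field.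
by rewrite !sinD cosN sinN; field.
Qed.

(** The form K + r cos is preserved when one variable is integrated out, which drives the induction
    on the dimension in [integral_box_trig_shift]. *)
Lemma integral_itv_trig (K r a x u v : R) : u < v ->
  (\int[lebesgue_measure]_(t in `[u, v[) (K + r * cos (a + x * t))%:E =
   (K * (v - u) + r * (trig_factor x u v * cos (a + x * ((u + v) / 2))))%:E)%E.
Proof.
move=> uv.
have cf : continuous (fun t : R => K + r * cos (a + x * t)).
  move=> t; apply: cvgD; first exact: cvg_cst.
  apply: cvgMr; apply: (@continuous_comp _ _ _ (fun t => a + x * t) cos).
    by apply: cvgD; [exact: cvg_cst|apply: cvgMr; exact: cvg_id].
  exact: continuous_cos.
rewrite integral_itv_bndo_bndc; last first.
  apply/measurable_EFinP; apply: measurable_funTS.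
  exact: continuous_measurable_fun.
pose G t := if x == 0 then t * cos a else sin (a + x * t) / x.
pose F t := K * t + r * G t.
have dF (t : R) : is_derive t (1 : R) F (K + r * cos (a + x * t)).
  rewrite /F /G; case: eqP => [->|/eqP x0].
    apply: is_derive_eq; rewrite !scaler1 !scaler0 ?mul0r ?addr0.
    by rewrite /GRing.scale/=; ring.
  apply: is_derive_eq; rewrite /GRing.scale /=.
  by field.
have cF : continuous F.
  by move=> t; apply: differentiable_continuous; apply/derivable1_diffP; case: (dF t).
rewrite (@continuous_FTC2 _ _ F)//.
- rewrite -EFinB; congr EFin; rewrite /F /G.
  case: eqP => [->|/eqP x0]; last by rewrite -trig_factorE//; field.
  by rewrite /trig_factor eqxx mul0r addr0; ring.
- exact/continuous_subspaceT.
- split.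
  + by move=> t _; case: (dF t).
  + by apply: cvg_at_right_filter; exact: cF.
  + by apply: cvg_at_left_filter; exact: cF.
- by move=> t _; rewrite derive1E; case: (dF t).
Qed.

End trigonometric_bounds.

Section box_integral.
Context (R : realType).

Definition box d (lo hi : 'I_d -> R) : set (d.-tuple R) :=
  [set t | forall i, lo i <= tnth t i < hi i].

Lemma measurable_box d (lo hi : 'I_d -> R) : measurable (box lo hi).
Proof.
rewrite (_ : box lo hi =
    \bigcap_(i in [set: 'I_d]) (@tnth _ R ^~ i @^-1` [set x | lo i <= x < hi i])).
  apply: fin_bigcap_measurable => // i _.
  rewrite -[X in measurable X]setTI; apply: measurable_tnth => //.
  have -> : [set x | lo i <= x < hi i] = `[lo i, hi i[%classic.
    by apply/seteqP; split=> x /=; rewrite in_itv.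
  exact: measurable_itv.
by apply/seteqP; split=> t /= h i; [move=> _|]; exact: h.
Qed.

Lemma lebesgue_box d (lo hi : 'I_d -> R) : (forall i, lo i <= hi i) ->
  lebesgue_tuple R d (box lo hi) = (\prod_(i < d) (hi i - lo i))%:E.
Proof.
move=> lohi.
have := @lebesgue_tuple_box R d (fun i => `[lo i, hi i[%classic) (fun i => measurable_itv _).
rewrite (_ : mkset _ = box lo hi); last first.
  by apply/seteqP; split=> t h i; have := h i; rewrite /= in_itv.
move=> ->; rewrite -prodEFin; apply: eq_bigr => i _.
by rewrite lebesgue_measure_itv/= lte_fin; case: ltgtP (lohi i) => // -> _; rewrite subrr.
Qed.

Lemma lebesgue_box_lty d (lo hi : 'I_d -> R) : (forall i, lo i <= hi i) ->
  (lebesgue_tuple R d (box lo hi) < +oo)%E.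
Proof. by move=> lohi; rewrite lebesgue_box// ltry. Qed.

Lemma box_cons d (lo hi : 'I_d.+1 -> R) :
  tuple_of_pair (n:=d) @^-1` box lo hi =
  `[lo ord0, hi ord0[%classic `*`
    box (fun i => lo (lift ord0 i)) (fun i => hi (lift ord0 i)).
Proof.
have tnth_lift (x : measurableTypeR R) (t : d.-tuple R) (j : 'I_d) :
    tnth (tuple_of_pair (x, t)) (lift ord0 j) = tnth t j.
  by rewrite !(tnth_nth x).
apply/seteqP; split=> -[x t].
  move=> h; split; first by have := h ord0; rewrite /= in_itv.
  by move=> i; rewrite -(tnth_lift x); exact: h.
move=> [/= Ax At] i; case: (unliftP ord0 i) => [j ->|->].
  by rewrite tnth_lift; exact: At.
by move: Ax; rewrite in_itv.
Qed.

Lemma ge0_integral_box_cons d (lo hi : 'I_d.+1 -> R) (f : d.+1.-tuple R -> \bar R) :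
  measurable_fun setT f -> (forall t, (0 <= f t)%E) ->
  (\int[lebesgue_tuple R d.+1]_(t in box lo hi) f t =
   \int[lebesgue_measure]_(x in `[lo ord0, hi ord0[)
     \int[lebesgue_tuple R d]_(t in
        box (fun i => lo (lift ord0 i)) (fun i => hi (lift ord0 i)))
       f [tuple of x :: t])%E.
Proof.
move=> mf f0.
have mB := measurable_box lo hi.
have mg : measurable_fun setT (f \o tuple_of_pair (n:=d)).
  by apply: measurableT_comp => //; exact: measurable_tuple_of_pair.
rewrite (ge0_integral_pushforward (@measurable_tuple_of_pair R d)
  (lebesgue_measure \x lebesgue_tuple R d)%E mB)//; last exact: measurable_funTS.
rewrite box_cons integral_mkcond.
set A := `[lo ord0, hi ord0[%classic; set B := box _ _.
have mAB : measurable (A `*` B).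
  by apply: measurableX; [exact: measurable_itv|exact: measurable_box].
rewrite fubini_tonelli1; last 2 first.
- by apply/measurable_restrict => //; exact: measurable_funTS.
- by move=> z; rewrite patchE; case: ifPn => // _; exact: f0.
rewrite [RHS]integral_mkcond; apply: eq_integral => x _.
rewrite patchE /fubini_F; case: ifPn => xA.
  rewrite [RHS]integral_mkcond; apply: eq_integral => t _.
  rewrite !patchE; congr (if _ then _ else _).
  by apply/idP/idP; rewrite !inE; [case|split => //; exact: set_mem].
apply: integral0_eq => t _; rewrite patchE; case: ifPn => //.
by rewrite inE => -[/= xA' _]; move: xA; rewrite notin_setE.
Qed.

Lemma measurable_trig d (a : R) (y : d.-tuple R) :
  measurable_fun setT (fun t : d.-tuple R => cos (a + dotp y t)).
Proof.
apply: (measurableT_comp (@continuous_measurable_fun _ _ (@continuous_cos R))).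
apply: measurable_funD => //; apply: measurable_sum => i.
by apply: measurable_funM => //; exact: measurable_tnth.
Qed.

(** The added 1 makes the integrand nonnegative, so that Tonelli applies coordinate by coordinate;
    [Rintegral_box_trig] subtracts the volume afterwards. *)
Lemma integral_box_trig_shift d (lo hi : 'I_d -> R) (a : R) (y : d.-tuple R) :
  (forall i, lo i < hi i) ->
  (\int[lebesgue_tuple R d]_(t in box lo hi) (1 + cos (a + dotp y t))%:E =
   (\prod_(i < d) (hi i - lo i) +
    (\prod_(i < d) trig_factor (tnth y i) (lo i) (hi i)) *
    cos (a + \sum_(i < d) tnth y i * ((lo i + hi i) / 2)))%:E)%E.
Proof.
elim: d lo hi a y => [|d IH] lo hi a y lohi.
  rewrite !big_ord0 mul1r addr0 (_ : box lo hi = setT); last first.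
    by apply/seteqP; split => // t _ [].
  rewrite (eq_integral (cst (1 + cos a)%:E)); last first.
    by move=> t _; rewrite /dotp big_ord0 addr0.
  by rewrite integral_cst//= diracT mule1.
rewrite ge0_integral_box_cons; last 2 first.
- apply/measurable_EFinP; apply: measurable_funD => //; exact: measurable_trig.
- by move=> t; rewrite lee_fin; have := @cos_geN1 R (a + dotp y t); lra.
pose y' := [tuple of behead y].
have y'E i : tnth y' i = tnth y (lift ord0 i).
  by rewrite !(tnth_nth 0) /= nth_behead.
have dotE x (t : d.-tuple R) : dotp y [tuple of x :: t] = tnth y ord0 * x + dotp y' t.
  rewrite /dotp big_ord_recl; congr (_ + _).
  apply: eq_bigr => i _; rewrite y'E; congr (_ * _).
  by rewrite !(tnth_nth 0).
under eq_integral => x _.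
  under eq_integral do rewrite dotE addrA.
  rewrite IH; last by move=> i; exact: lohi.
  rewrite -[a + _ + _]addrA [tnth y ord0 * x + _]addrC addrA.
  over.
rewrite integral_itv_trig//; congr EFin.
rewrite [in RHS]big_ord_recl [X in _ = _ + X * _]big_ord_recl.
rewrite [X in _ = _ + _ * cos (_ + X)]big_ord_recl.
have -> : \prod_(i < d) trig_factor (tnth y' i) (lo (lift ord0 i)) (hi (lift ord0 i)) =
    \prod_(i < d) trig_factor (tnth y (lift ord0 i)) (lo (lift ord0 i)) (hi (lift ord0 i)).
  by apply: eq_bigr => i _; rewrite y'E.
have -> : \sum_(i < d) tnth y' i * ((lo (lift ord0 i) + hi (lift ord0 i)) / 2) =
    \sum_(i < d) tnth y (lift ord0 i) * ((lo (lift ord0 i) + hi (lift ord0 i)) / 2).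
  by apply: eq_bigr => i _; rewrite y'E.
congr (_ + _); first by rewrite mulrC.
rewrite mulrCA mulrA; congr (_ * _).
by congr cos; rewrite -addrA [X in _ + X]addrC.
Qed.

Lemma integrable_box_trig d (lo hi : 'I_d -> R) (a : R) (y : d.-tuple R) :
  (forall i, lo i < hi i) ->
  (lebesgue_tuple R d).-integrable (box lo hi) (fun t => (cos (a + dotp y t))%:E).
Proof.
move=> lohi; apply: measurable_bounded_integrable.
- exact: measurable_box.
- by apply: lebesgue_box_lty => i; exact: ltW.
- by apply: measurable_funTS; exact: measurable_trig.
- exists 1; split; first exact: num_real.
  by move=> r r1 t _ /=; apply: (le_trans (cos_max _)); exact: ltW.
Qed.

Lemma Rintegral_box_trig d (lo hi : 'I_d -> R) (a : R) (y : d.-tuple R) :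
  (forall i, lo i < hi i) ->
  \int[lebesgue_tuple R d]_(t in box lo hi) cos (a + dotp y t) =
    (\prod_(i < d) trig_factor (tnth y i) (lo i) (hi i)) *
    cos (a + \sum_(i < d) tnth y i * ((lo i + hi i) / 2)).
Proof.
move=> lohi; have := integral_box_trig_shift a y lohi.
under eq_integral do rewrite EFinD.
have fin := lebesgue_box_lty (fun i => ltW (lohi i)).
rewrite integralD//; last 3 first.
- exact: measurable_box.
- apply: (@measurable_bounded_integrable _ _ _ _ (cst 1)) => //.
  + exact: measurable_box.
  + exists 1; split; first exact: num_real.
    by move=> r r1 t _ /=; rewrite normr1; exact: ltW.
- exact: integrable_box_trig.
rewrite integral_cst; last exact: measurable_box.
rewrite mul1e [X in (X + _)%E]lebesgue_box; last by move=> i; exact: ltW.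
rewrite /Rintegral; have /integrable_fin_num := integrable_box_trig a y lohi.
by case: (integral _ _ _) => [r _ [] /addrI|/(_ (measurable_box _ _))|/(_ (measurable_box _ _))].
Qed.

Lemma Rintegral_box_trig_le d (lo hi : 'I_d -> R) (a : R) (y : d.-tuple R) :
  (forall i, lo i < hi i) ->
  `|\int[lebesgue_tuple R d]_(t in box lo hi) cos (a + dotp y t)| <=
    \prod_(i < d) `|trig_factor (tnth y i) (lo i) (hi i)|.
Proof.
by move=> lohi; rewrite Rintegral_box_trig// normrM normr_prod ler_piMr ?cos_max// prodr_ge0.
Qed.

End box_integral.

(** * Cubes and cascade weights *)

Section cubes.
Context (R : realType) (d b : nat) (hb : (0 < b)%N).
Implicit Types (t : d.-tuple R) (m : nat).

Let bR m : 0 < (b ^ m)%:R :> R. Proof. by rewrite ltr0n expn_gt0 hb. Qed.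

(** Turns disjointness and nesting of cubes into integer arithmetic. The sign condition is there
    because [Num.truncn] sends negative numbers to 0. *)
Lemma cubeP m (h : cube_code d b m) t : cube h t <->
  forall i, 0 <= tnth t i /\ Num.truncn (tnth t i * (b ^ m)%:R) = h i.
Proof.
split=> H i; have := H i.
  rewrite ler_pdivrMr// ltr_pdivlMr// => hi; split; last exact: truncn_def.
  by case/andP: hi => h0 _; rewrite -(pmulr_lge0 _ (bR m)) (le_trans _ h0).
move=> [t0 tE]; rewrite ler_pdivrMr// ltr_pdivlMr// -tE.
by apply: truncn_itv; rewrite mulr_ge0// ltW.
Qed.

Lemma cube_inj m (g h : cube_code d b m) t : cube g t -> cube h t -> g = h.
Proof.
move=> /cubeP gt /cubeP ht; apply/ffunP => i; apply: val_inj => /=.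
by rewrite -(gt i).2 -(ht i).2.
Qed.

Lemma parent_subproof m (j : 'I_(b ^ m.+1)) : (j %/ b < b ^ m)%N.
Proof. by rewrite ltn_divLR// -expnSr. Qed.

Definition parent m (h : cube_code d b m.+1) : cube_code d b m :=
  [ffun i => Ordinal (parent_subproof (h i))].

Lemma truncn_divn (x : R) : 0 <= x -> Num.truncn x = (Num.truncn (x * b%:R) %/ b)%N.
Proof.
move=> x0; apply: truncn_def.
have /truncn_itv/andP[h1 h2] : 0 <= x * b%:R by rewrite mulr_ge0.
have b0 : 0 < b%:R :> R by rewrite ltr0n.
rewrite -(ler_pM2r b0) -(ltr_pM2r b0) -!natrM.
rewrite (le_trans _ h1) ?ler_nat ?leq_trunc_div//.
rewrite (lt_le_trans h2)// ler_nat.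
by rewrite -ltn_divLR// ltnSn.
Qed.

Lemma parentE m (h : cube_code d b m.+1) t i : cube h t ->
  (parent h i : nat) = Num.truncn (tnth t i * (b ^ m)%:R).
Proof.
move=> /cubeP /(_ i) [t0 tE]; rewrite ffunE /= -tE [RHS]truncn_divn ?mulr_ge0//.
by rewrite -mulrA -natrM -expnSr.
Qed.

Lemma cube_parent m (h : cube_code d b m.+1) t : cube h t -> cube (parent h) t.
Proof.
move=> ht; apply/cubeP => i; split; last by rewrite (parentE i ht).
by move/cubeP : ht => /(_ i)[].
Qed.

Lemma cube_child m (g : cube_code d b m) t : cube g t ->
  exists2 h : cube_code d b m.+1, parent h = g & cube h t.
Proof.
move=> gt; have /cubeP gtP := gt.
have lt i : (Num.truncn (tnth t i * (b ^ m.+1)%:R) < b ^ m.+1)%N.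
  have [t0 tE] := gtP i.
  rewrite expnSr natrM mulrA -ltn_divLR// -truncn_divn ?tE//.
  by rewrite mulr_ge0.
pose h : cube_code d b m.+1 := [ffun i => Ordinal (lt i)].
have ht : cube h t.
  by apply/cubeP => i; split; [case: (gtP i)|rewrite ffunE].
by exists h => //; apply: (cube_inj (cube_parent ht) gt).
Qed.

Lemma indic_cube_parent m (g : cube_code d b m) (h : cube_code d b m.+1) t :
  \1_(cube g) t * \1_(cube h) t = ((parent h == g)%:R * \1_(cube h) t : R).
Proof.
rewrite !indicE; have [ht|_] := boolP (t \in cube h); last by rewrite !mulr0.
suff -> : (t \in cube g) = (parent h == g) by [].
apply/idP/eqP => [gt|<-].
  by apply/esym/(@cube_inj _ g (parent h) t); [exact: set_mem|apply: cube_parent; exact: set_mem].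
by apply/mem_set/cube_parent/set_mem.
Qed.

Lemma indic_cube_children m (g : cube_code d b m) t :
  \1_(cube g) t = \sum_(h : cube_code d b m.+1 | parent h == g) \1_(cube h) t :> R.
Proof.
rewrite indicE; have [/set_mem/cube_child[h hg ht]|gt] := boolP (t \in cube g).
  rewrite (bigD1 h) ?hg//= indicE mem_set// big1 ?addr0// => h' /andP[_ h'h].
  rewrite indicE memNset// => h't; move/eqP: h'h; apply.
  exact: cube_inj h't ht.
rewrite big1// => h /eqP hg; rewrite indicE memNset// => ht.
by move/negP: gt; apply; apply/mem_set; rewrite -hg; exact: cube_parent.
Qed.

Lemma cube_sub_unit_cube m (h : cube_code d b m) : cube h `<=` @unit_cube R d.
Proof.
move=> t ht i; have := ht i; rewrite ler_pdivrMr// ltr_pdivlMr// => /andP[h1 h2].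
move/cubeP : ht => /(_ i)[-> _] /=.
rewrite -(ler_pM2r (bR m)) mul1r ltW// (lt_le_trans h2)// ler_nat.
exact: ltn_ord.
Qed.

Lemma measurable_cube m (h : cube_code d b m) : measurable (cube h : set (d.-tuple R)).
Proof. exact: measurable_box. Qed.

Lemma measurable_unit_cube : measurable (@unit_cube R d).
Proof.
rewrite (_ : @unit_cube R d =
    \bigcap_(i in [set: 'I_d]) (@tnth _ R ^~ i @^-1` `[0, 1]%classic)).
  apply: fin_bigcap_measurable => // i _.
  rewrite -[X in measurable X]setTI; apply: measurable_tnth => //.
by apply/seteqP; split=> t /= h i; [move=> _|]; have := h i; rewrite /= in_itv; [|apply].
Qed.

(** Real form of c_I: the phase [a] chooses between the real and the imaginary part, and [y] is an
    angular frequency. *)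
Definition cube_coef m (h : cube_code d b m) (a : R) (y : d.-tuple R) : R :=
  \int[lebesgue_tuple R d]_(t in cube h) cos (a + dotp y t).

Let lohi m (h : cube_code d b m) i :
  (h i)%:R / (b ^ m)%:R < (h i).+1%:R / (b ^ m)%:R :> R.
Proof. by rewrite ltr_pM2r ?invr_gt0// ltr_nat. Qed.

Let len m (h : cube_code d b m) i :
  (h i).+1%:R / (b ^ m)%:R - (h i)%:R / (b ^ m)%:R = ((b ^ m)%:R)^-1 :> R.
Proof. by rewrite -mulrBl -natr1 addrAC subrr add0r mul1r. Qed.

Lemma cube_coef_le_vol m (h : cube_code d b m) a y :
  `|cube_coef h a y| <= ((b ^ m)%:R)^-1 ^+ d.
Proof.
rewrite (le_trans (Rintegral_box_trig_le _ _ (lohi h)))//.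
have -> : ((b ^ m)%:R)^-1 ^+ d = \prod_(i < d) ((b ^ m)%:R)^-1 :> R.
  by rewrite prodr_const card_ord.
rewrite ler_prod// => i _.
by rewrite normr_ge0/= (le_trans (trig_factor_le_len _ (ltW (lohi h i))))// len.
Qed.

(** A single coordinate is exploited: its factor is at most 2/|y_i|, the d - 1 others are at most
    the side length. This gain of one power is the source of s <= 1. *)
Lemma cube_coef_le_freq m (h : cube_code d b m) a (y : d.-tuple R) i : tnth y i != 0 ->
  `|cube_coef h a y| <= ((b ^ m)%:R)^-1 ^+ d * (2 * (b ^ m)%:R / `|tnth y i|).
Proof.
move=> yi0; rewrite (le_trans (Rintegral_box_trig_le _ _ (lohi h)))//.
rewrite (bigD1 i)//=.
have -> : ((b ^ m)%:R)^-1 ^+ d * (2 * (b ^ m)%:R / `|tnth y i|) =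
    2 / `|tnth y i| * ((b ^ m)%:R^-1 : R) ^+ d.-1.
  have -> : ((b ^ m)%:R^-1 : R) ^+ d = (b ^ m)%:R^-1 * (b ^ m)%:R^-1 ^+ d.-1.
    by rewrite -exprS (prednK (leq_ltn_trans (leq0n _) (ltn_ord i))).
  by field; rewrite normr_eq0 yi0 /= gt_eqF.
apply: ler_pM => //; first by rewrite prodr_ge0.
  exact: trig_factor_le_inv.
have -> : d.-1 = #|[pred j : 'I_d | j != i]|.
  by have := cardC1 i; rewrite card_ord => <-; apply: eq_card.
rewrite -[leRHS]prodr_const ler_prod// => j _.
by rewrite normr_ge0/= (le_trans (trig_factor_le_len _ (ltW (lohi h j))))// len.
Qed.

Lemma integral_cube_restrict m (h : cube_code d b m) a y :
  (\int[lebesgue_tuple R d]_(t in @unit_cube R d)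
    (cos (a + dotp y t) * \1_(cube h) t)%:E = (cube_coef h a y)%:E)%E.
Proof.
have -> : (cube_coef h a y)%:E =
    (\int[lebesgue_tuple R d]_(t in cube h) (cos (a + dotp y t))%:E)%E.
  by rewrite fineK//; apply: integrable_fin_num; [exact: measurable_cube|exact: integrable_box_trig].
rewrite -[in RHS](classical_sets.setIidr (@cube_sub_unit_cube m h)) integral_mkcondr.
apply: eq_integral => t _; rewrite patchE indicE.
by case: ifPn; rewrite ?mulr1 ?mulr0.
Qed.

Lemma integrable_cube_restrict m (h : cube_code d b m) a y :
  (lebesgue_tuple R d).-integrable (@unit_cube R d)
    (fun t => (cos (a + dotp y t) * \1_(cube h) t)%:E).
Proof.
have := integrable_box_trig a y (lohi h) => /(integrable_mkcond _ (measurable_cube h)) H.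
apply: (@integrableS _ _ _ _ setT) => //; first exact: measurable_unit_cube.
apply: eq_integrable H => // t _ /=; rewrite patchE indicE.
by case: ifPn; rewrite ?mulr1 ?mulr0.
Qed.

Lemma integral_cube_sum m (Z : cube_code d b m -> R) a y :
  \int[lebesgue_tuple R d]_(t in @unit_cube R d)
    (cos (a + dotp y t) * \sum_h Z h * \1_(cube h) t) =
  \sum_h Z h * cube_coef h a y.
Proof.
rewrite /Rintegral.
rewrite (eq_integral (fun t => \sum_(h : cube_code d b m)
    ((Z h)%:E * (cos (a + dotp y t) * \1_(cube h) t)%:E))%E); last first.
  move=> t _; rewrite mulr_sumr -sumEFin; apply: eq_bigr => h _.
  by rewrite -EFinM mulrCA.
rewrite integral_sum//; last 2 first.
- exact: measurable_unit_cube.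
- move=> h; apply: integrableZl; first exact: measurable_unit_cube.
  exact: integrable_cube_restrict.
rewrite (eq_bigr (fun h => (Z h * cube_coef h a y)%:E)) ?sumEFin// => h _.
rewrite integralZl//; last 2 first.
- exact: measurable_unit_cube.
- exact: integrable_cube_restrict.
by rewrite [X in (_ * X)%E]integral_cube_restrict.
Qed.

(** Both sides are read off from [integral_cube_sum], with weights selecting g or its children; the
    two integrands agree pointwise. *)
Lemma cube_coef_children m (g : cube_code d b m) a y :
  cube_coef g a y = \sum_(h : cube_code d b m.+1 | parent h == g) cube_coef h a y.
Proof.
have := @integral_cube_sum m (fun h => (h == g)%:R) a y.
rewrite (bigD1 g)//= eqxx mul1r big1 ?addr0; last by move=> h /negbTE ->; rewrite mul0r.
move=> <-; have := @integral_cube_sum m.+1 (fun h => (parent h == g)%:R) a y.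
rewrite [RHS](bigID (fun h => parent h == g))/= [X in _ + X]big1 ?addr0; last first.
  by move=> h /negbTE ->; rewrite mul0r.
rewrite [in RHS](eq_bigr (fun h => cube_coef h a y)); last by move=> h ->; rewrite mul1r.
move=> <-; apply: eq_Rintegral => t _; congr (_ * _).
rewrite (bigD1 g)//= eqxx mul1r big1 ?addr0; last by move=> h /negbTE ->; rewrite mul0r.
rewrite indic_cube_children big_mkcond/=; apply: eq_bigr => h _.
by case: ifP; rewrite ?mul1r ?mul0r.
Qed.

Section weights.
Context (T : Type) (W : cascade_index d b -> T -> R).

(** The weight of the cube itself is included, so Q_I is the value at the parent of I. *)
Fixpoint cube_weight m : cube_code d b m -> T -> R :=
  match m with
  | 0%N => fun _ _ => 1
  | k.+1 => fun h w => cube_weight (parent h) w * W (existT _ k h) w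
  end.

(** Stated from level 1 on: at level 0 the density is 1 everywhere, whereas the sum would be the
    indicator of the half-open unit cube. *)
Lemma cascade_densityE w m t : cascade_density W w m.+1 t =
  \sum_(h : cube_code d b m.+1) cube_weight h w * \1_(cube h) t.
Proof.
elim: m => [|m IH].
  rewrite /cascade_density big_ord_recl big_ord_recl big_ord0 /= mulr1 mul1r.
  by apply: eq_bigr => h _; rewrite mul1r.
rewrite /cascade_density big_ord_recr/= -/(cascade_density W w m.+1 t) IH.
rewrite mulr_sumr; apply: eq_bigr => h _.
rewrite mulr_suml (bigD1 (parent h))//= big1 ?addr0 => [|g gh].
  have := indic_cube_parent (parent h) h t; rewrite eqxx mul1r => E.
  by rewrite -[in RHS]E; ring.
have := indic_cube_parent g h t; rewrite eq_sym (negbTE gh) mul0r => E.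
by rewrite mulrACA [X in _ * X]E mulr0.
Qed.

Definition cascade_sum (a : R) y m (w : T) : R :=
  \sum_(h : cube_code d b m) cube_weight h w * cube_coef h a y.

Lemma integral_cascade_density w m a y :
  \int[lebesgue_tuple R d]_(t in @unit_cube R d)
    (cos (a + dotp y t) * cascade_density W w m.+1 t) = cascade_sum a y m.+1 w.
Proof.
rewrite /cascade_sum -(integral_cube_sum (fun h => cube_weight h w)).
apply: eq_Rintegral => t _.
by rewrite cascade_densityE.
Qed.

(** Splitting each coefficient over the children rewrites level m as level m+1 with the new weights
    set to 1; hence the centred factors W_I - 1. *)
Lemma cascade_sumS a y m w : cascade_sum a y m.+1 w = cascade_sum a y m w +
  \sum_(h : cube_code d b m.+1)
     (W (existT _ m h) w - 1) * (cube_weight (parent h) w * cube_coef h a y).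
Proof.
have -> : cascade_sum a y m w =
    \sum_(h : cube_code d b m.+1) cube_weight (parent h) w * cube_coef h a y.
  rewrite (partition_big (@parent m) xpredT)//=; apply: eq_bigr => g _.
  rewrite cube_coef_children mulr_sumr; apply: eq_bigr => h /eqP <- //.
rewrite -big_split/=; apply: eq_bigr => h _.
by rewrite mulrBl mul1r addrC subrK mulrA [W _ _ * _]mulrC.
Qed.

End weights.

End cubes.

(** * Moment bounds for the cascade *)

Section cascade_moment.
Context (R : realType) (d b : nat) (hb : (0 < b)%N).
Context (dQ : measure_display) (Omega' : measurableType dQ).
Context (Q : probability Omega' R) (W : {RV Q >-> R}).
Context (dO : measure_display) (Omega : measurableType dO).
Variable P : probability Omega R.
Context (X : cascade_index d b -> {RV P >-> R}).
Hypotheses (indepX : mutually_independent X) (lawX : forall I, same_law (X I) W).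
Variables (p : R) (q : nat).
Hypotheses (qeven : ~~ odd q) (q2 : (2 <= q)%N) (p12 : 1 < p <= 2).
Hypothesis EW1 : ('E_Q[W] = 1)%E.
Variable a : R.
Hypothesis a1 : 1 <= a.
Hypothesis EWp : (\int[Q]_x (`|W x| `^ p)%:E = a%:E)%E.

Let Xf (I : cascade_index d b) : Omega -> R := X I.

(** [I] has level [projT1 I + 1], so h lies at a strictly coarser level and its weight does not
    involve [X I]. *)
Lemma measurable_cube_weight m (h : cube_code d b m) I : (m <= projT1 I)%N ->
  measurable_fun [set: sigma_off X I] (cube_weight hb Xf h : sigma_off X I -> R).
Proof.
elim: m h => [|m IH] h mI /=; first exact: measurable_cst.
apply: measurable_funM; first by apply: IH; exact: ltnW.
apply: (@measurable_sigma_off _ _ _ P _ X I (existT _ m h)).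
by apply: contraTneq mI => <- /=; rewrite ltnn.
Qed.

Lemma cube_weight_moment m (h : cube_code d b m) :
  (\int[P]_w (`|cube_weight hb Xf h w| `^ p)%:E = (a ^+ m)%:E)%E.
Proof.
elim: m h => [|m IH] h.
  by rewrite /= normr1 powR1 expr0; have := expectation_cst P 1; rewrite unlock.
have mQ := @measurable_cube_weight m (parent hb h) (existT _ m h) (leqnn m).
rewrite (weight_moment_step indepX lawX EWp mQ) IH.
by rewrite -EFinM -exprS.
Qed.

Lemma lqp_le_unif (N : finType) (u : N -> R) (V : R) : (forall n, `|u n| <= V) ->
  lqp q p u <= #|N|%:R `^ (p / q%:R) * V `^ p.
Proof.
move=> uV; have [n _|N0] := pickP (fun _ : N => true); last first.
  rewrite /lqp big_pred0// powR0 ?mulr_ge0 ?powR_ge0//.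
  case/andP: p12 => p1 _; rewrite mulf_neq0 ?invr_eq0 ?gt_eqF//; first lra.
  by rewrite ltr0n (leq_trans _ q2).
have V0 : 0 <= V by apply: le_trans (uV n).
have q0 : q%:R != 0 :> R by rewrite pnatr_eq0 -lt0n (leq_trans _ q2).
have -> : V `^ p = (V ^+ q) `^ (p / q%:R).
  by rewrite -powR_mulrn// -powRrM mulrCA divff// mulr1.
rewrite -powRM ?exprn_ge0//; apply: ge0_ler_powR.
- by case/andP: p12 => ? _; rewrite divr_ge0//; lra.
- by rewrite nnegrE sumr_ge0// => i _; exact: exprn_even_ge0.
- by rewrite nnegrE mulr_ge0// exprn_ge0.
rewrite mulr_natl -[X in _ *+ X]/(#|N|) -sumr_const ler_sum// => i _.
by rewrite even_expr_norm// lerXn2r ?nnegrE.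
Qed.

Variables (N : finType) (al : N -> R) (y : N -> d.-tuple R) (V : nat -> R).
Hypothesis coefV : forall m (h : cube_code d b m) n, `|cube_coef h (al n) (y n)| <= V m.

Let S m (n : N) (w : Omega) : R := cascade_sum hb Xf (al n) (y n) m w.

Let v (I : cascade_index d b) (n : N) (w : Omega) : R :=
  cube_weight hb Xf (parent hb (projT2 I)) w * cube_coef (projT2 I) (al n) (y n).

Let int_v I : (\int[P]_w (lqp q p (v I ^~ w))%:E <=
  (a ^+ (projT1 I) * (#|N|%:R `^ (p / q%:R) * V (projT1 I).+1 `^ p))%:E)%E.
Proof.
case: I => m h; rewrite /v /=.
pose Z := cube_weight hb Xf (parent hb h).
have mZ : measurable_fun setT Z.
  have mQ := @measurable_cube_weight m (parent hb h) (existT _ m h) (leqnn m).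
  exact: (measurableT_comp mQ (@measurable_to_off _ _ _ P _ X (existT _ m h))).
pose c := lqp q p (fun n => cube_coef h (al n) (y n)).
rewrite (eq_integral (fun w => c%:E * (`|Z w| `^ p)%:E)%E); last first.
  by move=> w _; rewrite -EFinM /c mulrC -lqp_scale.
have c0 : 0 <= c by exact: lqp_ge0.
rewrite ge0_integralZl_EFin//; last first.
  apply/measurable_EFinP; apply: (measurableT_comp (measurable_powR p)).
  exact: measurableT_comp.
rewrite cube_weight_moment -EFinM lee_fin mulrC ler_wpM2l//.
  by rewrite exprn_ge0// (le_trans ler01).
by apply: lqp_le_unif => n; exact: coefV.
Qed.

Let measurable_S m n I : (m <= projT1 I)%N ->
  measurable_fun [set: sigma_off X I] (S m n : sigma_off X I -> R).
Proof.
move=> mI; apply: measurable_sum => h; apply: measurable_funM => //.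
exact: measurable_cube_weight.
Qed.

Lemma measurable_cascade_sum al' y' m :
  measurable_fun setT (cascade_sum hb Xf al' y' m).
Proof.
apply: measurable_sum => h; apply: measurable_funM => //.
elim: m h => [|m IH] h /=; first exact: measurable_cst.
by apply: measurable_funM => //; exact: measurable_funP.
Qed.

(** Each summand is the number of cubes of level j, a bound for the moment of Q_I, and the
    coefficient bound to the power p. For j >= 1 the exact moment is a^(j-1); since a >= 1, a^j
    bounds it and fits level 0 too. The 1 added to [smooth_cst] pays for level 0. *)
Definition moment_bound m : R := (1 + smooth_cst W p q) *
  #|N|%:R `^ (p / q%:R) * \sum_(j < m.+1) ((b ^ j)%:R ^+ d * a ^+ j * V j `^ p).

Lemma cascade_moment m :
  (\int[P]_w (lqp q p (fun n => cascade_sum hb Xf (al n) (y n) m w))%:E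
    <= (moment_bound m)%:E)%E.
Proof.
have K0 := smooth_cst_ge0 W p q.
elim: m => [|m IH].
  have E w : lqp q p (fun n => cascade_sum hb Xf (al n) (y n) 0 w) <=
      #|N|%:R `^ (p / q%:R) * V 0%N `^ p.
    apply: lqp_le_unif => n; rewrite /cascade_sum.
    pose h0 : cube_code d b 0 := [ffun i => Ordinal (ltn0Sn 0)].
    rewrite (bigD1 h0)//= big1 ?addr0 ?mul1r// => h /eqP hh0.
    by case: hh0; apply/ffunP => i; apply: val_inj; rewrite ffunE/=; case: (h i) => [[]].
  apply: (@le_trans _ _ (\int[P]_w (#|N|%:R `^ (p / q%:R) * V 0%N `^ p)%:E)%E).
    apply: ge0_le_integral => //.
    - by move=> w _; rewrite lee_fin lqp_ge0.
    - apply/measurable_EFinP/(@measurable_lqp _ p q _ _ _ (fun n => cascade_sum hb Xf (al n) (y n) 0)) => n.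
      exact: measurable_cascade_sum.
    - by move=> w _; rewrite lee_fin.
  have := expectation_cst P (#|N|%:R `^ (p / q%:R) * V 0%N `^ p); rewrite unlock => ->.
  rewrite lee_fin /moment_bound big_ord_recl big_ord0 addr0 expn0 expr1n expr0 !mul1r.
  rewrite -mulrA ler_peMl ?mulr_ge0 ?powR_ge0//; lra.
(* The cubes of level m+1, whose weights are revealed in this step. *)
pose r := [seq existT (fun m => cube_code d b m.+1) m h | h <- enum (cube_code d b m.+1)].
have ur : uniq r.
  rewrite map_inj_uniq ?enum_uniq// => h h' /eqP.
  by rewrite -!/(Tagged (fun m => cube_code d b m.+1) _) eq_Tagged => /eqP.
have rm I : I \in r -> projT1 I = m by move=> /mapP[h _ ->].
rewrite (eq_integral (fun w => (lqp q p (fun n => S m n w +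
    \sum_(I <- r) (X I w - 1) * v I n w))%:E)); last first.
  move=> w _; congr (lqp _ _ _)%:E; apply/funext => n.
  by rewrite cascade_sumS /r big_map big_enum.
apply: (le_trans (lqp_increments indepX lawX qeven q2 p12 EW1 EWp ur _ _)).
- by move=> I n /rm Im; apply: measurable_S; rewrite Im.
- move=> I J n /rm Im /rm Jm; apply: measurable_funM => //.
  by apply: measurable_cube_weight; rewrite Im Jm.
rewrite /moment_bound big_ord_recr/= mulrDr EFinD; apply: leeD; first exact: IH.
apply: (@le_trans _ _ ((smooth_cst W p q)%:E * \sum_(I <- r)
    (a ^+ m * (#|N|%:R `^ (p / q%:R) * V m.+1 `^ p))%:E)%E).
  rewrite lee_wpmul2l ?lee_fin//.
  rewrite big_seq [X in (_ <= X)%E]big_seq lee_sum// => I /rm Im.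
  by have := int_v I; rewrite Im.
rewrite sumEFin -EFinM lee_fin /r big_map big_enum sumr_const card_ffun !card_ord.
rewrite -[X in _ * X <= _]mulr_natl [((_ ^ _) ^ _)%:R]natrX [a ^+ m.+1]exprS.
set K := smooth_cst W p q; set M := _ ^+ d; set U := _ `^ _; set Vp := _ `^ p.
have K0' : 0 <= K by [].
have M0 : 0 <= M by exact: exprn_ge0.
have U0 : 0 <= U by exact: powR_ge0.
have Vp0 : 0 <= Vp by exact: powR_ge0.
have am0 : 0 <= a ^+ m by rewrite exprn_ge0// (le_trans ler01).
have Z0 : 0 <= M * a ^+ m * U * Vp by rewrite !mulr_ge0.
have : K * (M * a ^+ m * U * Vp) <= (1 + K) * a * (M * a ^+ m * U * Vp).
  rewrite ler_wpM2r//; have : (1 + K) * 1 <= (1 + K) * a by apply: ler_wpM2l => //; lra.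
  lra.
have -> : (1 + K) * a * (M * a ^+ m * U * Vp) = (1 + K) * U * (M * (a * a ^+ m) * Vp).
  by ring.
by have -> : K * (M * a ^+ m * U * Vp) = K * (M * (a ^+ m * (U * Vp))) by ring.
Qed.

End cascade_moment.

(** * Almost sure bounds from summable moments *)

Section summable_moments.
Context (R : realType) (dO : measure_display) (Omega : measurableType dO).
Variable P : probability Omega R.

Lemma limn_einf_le (u : (\bar R)^nat) (c : \bar R) :
  (forall n, (u n <= c)%E) -> (limn_einf u <= c)%E.
Proof.
move=> uc; rewrite limn_einf_lim; apply: lime_le; first exact: is_cvg_einfs.
apply: nearW => n; apply: le_trans (uc n).
by apply: ereal_inf_lbound; exists n => /=.
Qed.

Lemma limn_einf_ge (u : (\bar R)^nat) (c : \bar R) :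
  (\forall n \near \oo, (c <= u n)%E) -> (c <= limn_einf u)%E.
Proof.
move=> [n0 _ uc]; rewrite limn_einf_lim; apply: lime_ge; first exact: is_cvg_einfs.
exists n0 => // n /= n0n; apply: le_ereal_inf_tmp => _ [m /= nm <-].
by apply: uc; exact: leq_trans n0n nm.
Qed.

(** The sum of all Z_k has finite mean, so it is almost surely finite, and it dominates every term.
    Values are extended because a lower limit will be inserted. *)
Lemma ae_bounded_of_geometric_moments (Z : nat -> Omega -> \bar R) (C r : R) :
  (forall k, measurable_fun setT (Z k)) -> (forall k w, (0 <= Z k w)%E) ->
  0 <= C -> 0 < r < 1 ->
  (forall k, (\int[P]_w Z k w <= (C * r ^+ k)%:E)%E) ->
  \forall w \ae P, exists K : R, forall k, (Z k w <= K%:E)%E.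
Proof.
move=> mZ Z0 C0 /andP[r0 r1] ZC.
have r1' : `|r| < 1 by rewrite gtr0_norm.
pose Y w := (\sum_(k <oo) Z k w)%E.
have mY : measurable_fun setT Y by exact: ge0_emeasurable_sum.
have Y0 w : (0 <= Y w)%E by exact: nneseries_ge0.
have iY : P.-integrable setT Y.
  apply/integrableP; split => //.
  under eq_integral do rewrite gee0_abs//.
  rewrite integral_nneseries//; apply: (@le_lt_trans _ _ (C * (1 - r)^-1)%:E); last exact: ltry.
  apply: lime_le; first by apply: is_cvg_nneseries => k _ _; exact: integral_ge0.
  apply: nearW => n; apply: (@le_trans _ _ (\sum_(0 <= k < n) (C * r ^+ k)%:E)%E).
    exact: lee_sum.
  rewrite sumEFin lee_fin; apply: le_trans (geometric_le_lim n C0 r0 r1').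
  by rewrite /series /=.
have := integrable_ae measurableT iY; apply: filterS => w /(_ Logic.I) Yfin.
exists (fine (Y w)) => k; rewrite fineK//.
have := @nneseries_lim_ge R (Z ^~ w) xpredT 0 k.+1 (fun _ _ _ => Z0 _ w).
apply: le_trans; rewrite big_nat_recr//= leeDr//.
by apply: sume_ge0 => j _.
Qed.

End summable_moments.

Lemma norm_le_lqp (R : realType) (N : finType) q (p : R) (u : N -> R) n :
  ~~ odd q -> (2 <= q)%N -> 0 <= p -> `|u n| `^ p <= lqp q p u.
Proof.
move=> qeven q2 p0.
have q0 : q%:R != 0 :> R by rewrite pnatr_eq0 -lt0n (leq_trans _ q2).
have -> : `|u n| `^ p = (u n ^+ q) `^ (p / q%:R).
  rewrite (even_expr_norm _ qeven) -powR_mulrn// -powRrM.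
  by rewrite mulrCA divff// mulr1.
apply: ge0_ler_powR; first by rewrite divr_ge0.
- by rewrite nnegrE exprn_even_ge0.
- by rewrite nnegrE sumr_ge0// => i _; exact: exprn_even_ge0.
by rewrite (bigD1 n)//= lerDl sumr_ge0// => i _; exact: exprn_even_ge0.
Qed.

(** * Almost sure decay on the frequency grid *)

Section grid_decay.
Context (R : realType) (d b : nat) (hb : (1 < b)%N).
Context (dQ : measure_display) (Omega' : measurableType dQ).
Context (Q : probability Omega' R) (W : {RV Q >-> R}).
Context (dO : measure_display) (Omega : measurableType dO).
Variable P : probability Omega R.
Context (X : cascade_index d b -> {RV P >-> R}).
Hypotheses (indepX : mutually_independent X) (lawX : forall I, same_law (X I) W).
Variables (p : R) (p12 : 1 < p <= 2).
Hypothesis EW1 : ('E_Q[W] = 1)%E.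
Variable a : R.
Hypothesis a1 : 1 <= a.
Hypothesis EWp : (\int[Q]_x (`|W x| `^ p)%:E = a%:E)%E.

Let b0 : (0 < b)%N := ltnW hb.
Let B : R := b%:R.
Let B1 : 1 < B. Proof. by rewrite /B ltr1n. Qed.
Let B0 : 0 < B. Proof. exact: lt_trans B1. Qed.
Let Bn0 : B != 0. Proof. by rewrite gt_eqF. Qed.
Let BD x y : B `^ (x + y) = B `^ x * B `^ y.
Proof. by rewrite powRD// Bn0 implybT. Qed.
Let BX x n : (B `^ x) ^+ n = B `^ (x * n%:R).
Proof. by rewrite powRrM powR_mulrn ?powR_ge0. Qed.

Variables (s s' A c0 : R).
Hypotheses (s's : 0 <= s' < s) (A0 : 0 <= A) (c00 : 0 <= c0).
Hypothesis theta1 : B `^ (d%:R * (1 - p) + s * p) * a < 1.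
Variables (N : nat -> finType) (al : forall k, N k -> R) (y : forall k, N k -> d.-tuple R).
Hypothesis cardN : forall k, #|N k|%:R <= A * B `^ (2 * d%:R * k%:R).
Hypothesis coefN : forall k m (h : cube_code d b m) (n : N k),
  `|cube_coef h (al n) (y n)| <= c0 * ((b ^ m)%:R)^-1 ^+ d * B `^ (s * (m%:R - k%:R)).

Let Xf (I : cascade_index d b) : Omega -> R := X I.

Let theta := B `^ (d%:R * (1 - p) + s * p) * a.

Let theta0 : 0 < theta.
Proof. by rewrite mulr_gt0 ?powR_gt0// (lt_le_trans ltr01). Qed.

Let V k m := c0 * ((b ^ m)%:R)^-1 ^+ d * B `^ (s * (m%:R - k%:R)).

(** The exponents of b are dm from the count, -dmp from the volumes and sp(m-k) from the
    oscillation: ratio theta in the level m, gain b^(-spk) in the frequency scale k. *)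
Let term_bound k m : (b ^ m)%:R ^+ d * a ^+ m * V k m `^ p =
  c0 `^ p * B `^ (- (s * p * k%:R)) * theta ^+ m.
Proof.
have bE : (b ^ m)%:R = B `^ m%:R :> R by rewrite natrX powR_mulrn// ltW.
have iE : ((b ^ m)%:R)^-1 ^+ d = B `^ (- (m%:R * d%:R)) :> R.
  by rewrite bE -powRN BX mulNr.
rewrite /V iE powRM ?powR_ge0//; last by rewrite mulr_ge0 ?powR_ge0.
rewrite powRM ?powR_ge0// -!powRrM bE BX /theta exprMn BX.
have -> : (d%:R * (1 - p) + s * p) * m%:R =
    m%:R * d%:R + - (m%:R * d%:R) * p + s * (m%:R - k%:R) * p + s * p * k%:R by ring.
rewrite !BD.
have : B `^ (- (s * p * k%:R)) * B `^ (s * p * k%:R) = 1.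
  by rewrite -BD addNr powRr0.
set e1 := B `^ (- (s * p * k%:R)); set e2 := B `^ (s * p * k%:R) => e12.
rewrite (_ : c0 `^ p * e1 * _ = (e1 * e2) * (c0 `^ p * (B `^ (m%:R * d%:R) *
  B `^ (- (m%:R * d%:R) * p) * B `^ (s * (m%:R - k%:R) * p) * a ^+ m))); last by ring.
by rewrite e12 mul1r; ring.
Qed.

(** Convergence is a premise inside the almost sure event, to be supplied by the weak limit; the
    random constant K is chosen before k, the grid point and the limit. *)
Lemma grid_decay : \forall w \ae P, exists K : R, 0 <= K /\
  forall k (n : N k) l, cascade_sum b0 Xf (al n) (y n) m w @[m --> \oo] --> l ->
    `|l| <= K * B `^ (- (s' * k%:R)).
Proof.
have [s'0 ss] := andP s's; have [p1 p2] := andP p12.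
have p0 : 0 < p by lra.
(* q is large enough for the cardinality of the grid to cost less than s - s'. *)
pose q := (2 * (Num.truncn (2 * d%:R / (s - s'))).+1)%N.
have qeven : ~~ odd q by rewrite /q oddM.
have q2 : (2 <= q)%N by rewrite /q mulnS leq_addr.
have ss0 : 0 < s - s' by rewrite subr_gt0.
have qd : 2 * d%:R / q%:R < s - s'.
  rewrite ltr_pdivrMr ?ltr0n ?(leq_trans _ q2)// [ltRHS]mulrC -ltr_pdivrMr//.
  have /truncn_itv/andP[_ h] : 0 <= 2 * d%:R / (s - s').
    by rewrite divr_ge0// ?mulr_ge0// ltW.
  apply: (lt_le_trans h); rewrite ler_nat /q mul2n -addnn; exact: leq_addr.
have q0 : 0 < q%:R :> R by rewrite ltr0n (leq_trans _ q2).
pose S k m (w : Omega) := lqp q p (fun n : N k => cascade_sum b0 Xf (al n) (y n) m w).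
pose beta k : R := B `^ (s' * p * k%:R).
have beta0 k : 0 < beta k by exact: powR_gt0.
pose Z k w : \bar R := ((beta k)%:E * limn_einf (fun m => (S k m w)%:E))%E.
have K0 := smooth_cst_ge0 W p q.
(* Per unit of k: s'p from the normalisation [beta], -sp from [term_bound], and 2dp/q from the
   cardinality; the sum is negative by the choice of q. *)
pose r := B `^ (p * (s' - s + 2 * d%:R / q%:R)).
pose C := (1 + smooth_cst W p q) * A `^ (p / q%:R) * c0 `^ p * (1 - theta)^-1.
have mS k m : measurable_fun setT (fun w => (S k m w)%:E).
  apply/measurable_EFinP/(@measurable_lqp _ p q _ _ _ (fun n => cascade_sum b0 Xf (al n) (y n) m)) => n.
  exact: measurable_cascade_sum.
have mlim k : measurable_fun setT (fun w => limn_einf (fun m => (S k m w)%:E)).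
  apply: measurableT_comp => //.
  apply: (@measurable_fun_limn_esup _ _ _ _ (fun m w => - (S k m w)%:E)%E) => m.
  exact: measurableT_comp.
have lim0 k w : (0 <= limn_einf (fun m => (S k m w)%:E))%E.
  by apply: limn_einf_ge; apply: nearW => m; rewrite lee_fin lqp_ge0.
have C0 : 0 <= C.
  by rewrite !mulr_ge0 ?powR_ge0 ?invr_ge0 ?subr_ge0 ?(ltW theta1)//; lra.
have r01 : 0 < r < 1.
  rewrite powR_gt0//= /r /powR (negbTE Bn0) expR_lt1 nmulr_rlt0 ?ln_gt0//.
  by rewrite pmulr_rlt0//; lra.
have Zmom k : (\int[P]_w Z k w <= (C * r ^+ k)%:E)%E.
  rewrite ge0_integralZl_EFin//; last exact: ltW.
  apply: (@le_trans _ _ ((beta k)%:E * ((1 + smooth_cst W p q) *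
     #|N k|%:R `^ (p / q%:R) * (c0 `^ p * B `^ (- (s * p * k%:R)) * (1 - theta)^-1))%:E)%E).
    apply: lee_wpmul2l; first by rewrite lee_fin ltW.
    have h := @fatou _ _ _ P setT measurableT (fun m w => (S k m w)%:E) (mS k)
      (fun m w _ => lqp_ge0 q p _).
    apply: (le_trans h).
    apply: limn_einf_le => m.
    apply: (le_trans (cascade_moment b0 indepX lawX qeven q2 p12 EW1 a1 EWp (@coefN k) m)).
    rewrite lee_fin /moment_bound ler_wpM2l ?mulr_ge0 ?powR_ge0//; first lra.
    under eq_bigr do rewrite -/(V k _) term_bound.
    rewrite -mulr_sumr ler_wpM2l ?mulr_ge0 ?powR_ge0//.
    have := @geometric_le_lim R m.+1 1 theta ler01 theta0.
    rewrite gtr0_norm// mul1r => /(_ theta1).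
    rewrite /series /= big_mkord; apply: le_trans.
    by apply: ler_sum => i _; rewrite /= ?mul1r.
  rewrite -EFinM lee_fin.
  have hN : #|N k|%:R `^ (p / q%:R) <= A `^ (p / q%:R) * B `^ (2 * d%:R * k%:R * (p / q%:R)).
    rewrite [X in _ <= _ * X]powRrM -powRM ?powR_ge0//; apply: ge0_ler_powR.
    - by rewrite divr_ge0// ltW.
    - by rewrite nnegrE.
    - by rewrite nnegrE mulr_ge0// powR_ge0.
    - exact: cardN.
  have -> : C * r ^+ k = beta k * ((1 + smooth_cst W p q) *
     (A `^ (p / q%:R) * B `^ (2 * d%:R * k%:R * (p / q%:R))) *
     (c0 `^ p * B `^ (- (s * p * k%:R)) * (1 - theta)^-1)).
    have -> : r ^+ k = beta k * (B `^ (2 * d%:R * k%:R * (p / q%:R)) * B `^ (- (s * p * k%:R))).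
      rewrite /r BX /beta -!BD; congr (_ `^ _); field; exact: lt0r_neq0.
    by rewrite /C; ring.
  rewrite ler_wpM2l ?(ltW (beta0 k))// ler_wpM2r ?mulr_ge0 ?powR_ge0 ?invr_ge0 ?subr_ge0 ?(ltW theta1)//.
  by rewrite ler_wpM2l//; lra.
have Z0 k w : (0 <= Z k w)%E by rewrite mule_ge0// lee_fin ltW.
have mZ k : measurable_fun setT (Z k) by exact: measurable_funeM.
have := ae_bounded_of_geometric_moments mZ Z0 C0 r01 Zmom.
apply: filterS => w [K0' ZK].
(* K exceeds K0' strictly, which is what the contradiction at the end rests on. *)
pose K := `|K0'| + 1; have Kp : 0 < K by rewrite ltr_wpDl.
exists (K `^ p^-1); split; first exact: powR_ge0.
move=> k n l Sl; rewrite leNgt; apply/negP => cl.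
set c := K `^ p^-1 * B `^ (- (s' * k%:R)) in cl.
have c0' : 0 <= c by rewrite mulr_ge0 ?powR_ge0.
have cp : c `^ p = K / beta k.
  rewrite powRM ?powR_ge0// -!powRrM mulVf ?gt_eqF// powRr1 ?ltW//.
  by rewrite /beta -powRN mulNr mulrAC.
have : ((c `^ p)%:E <= limn_einf (fun m => (S k m w)%:E))%E.
  apply: limn_einf_ge.
  apply: filterS (cvgr_norm_ge l Sl _ cl) => m cm; rewrite lee_fin.
  pose u (n : N k) := cascade_sum b0 Xf (al n) (y n) m w.
  apply: le_trans (norm_le_lqp u n qeven q2 (ltW p0)).
  by apply: ge0_ler_powR; rewrite ?nnegrE ?(ltW p0).
have := ZK k; rewrite /Z => h1 h2.
have : ((beta k)%:E * (c `^ p)%:E <= K0'%:E)%E.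
  by apply: le_trans h1; rewrite lee_wpmul2l// lee_fin ltW.
rewrite -EFinM lee_fin cp mulrCA divff ?gt_eqF// mulr1 /K.
by have := ler_norm K0'; lra.
Qed.

End grid_decay.

(** * The frequency grid *)

Section frequency_grid.
Context (R : realType) (d b : nat) (hb : (1 < b)%N) (hd : (0 < d)%N).
Local Notation Rd := (d.-tuple R).

Definition angular (x : Rd) : Rd := [tuple - (2 * pi) * tnth x i | i < d].

Lemma tnth_angular x i : tnth (angular x) i = - (2 * pi) * tnth x i.
Proof. exact: tnth_mktuple. Qed.

Lemma dotp_angular (x t : Rd) : dotp (angular x) t = - (2 * pi * dotp x t).
Proof.
rewrite /dotp mulr_sumr -sumrN; apply: eq_bigr => i _.
by rewrite tnth_angular mulNr mulrA mulNr.
Qed.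

(** Along each axis, the 2 b^(2k+1) points of mesh b^(-k) in [-b^(k+1), b^(k+1)). *)
Definition grid_index (k : nat) : finType :=
  ({ffun 'I_d -> 'I_(2 * b ^ (2 * k).+1)} * bool)%type.

(* The boolean selects the real (false) or imaginary (true) part. *)
Definition phase (e : bool) : R := if e then - (pi / 2) else 0.

Definition grid_point k (n : grid_index k) : Rd :=
  [tuple ((n.1 i)%:R - (b ^ (2 * k).+1)%:R) / (b ^ k)%:R | i < d].

(** A vector of length at least b^k has a coordinate of size at least b^k/d; half of it survives the
    rounding to the grid. *)
Definition grid_large k : pred (grid_index k) := fun n =>
  [exists i, (b ^ k)%:R / (2 * d%:R) <= `|tnth (grid_point n) i|].

Definition grid k : finType := {n : grid_index k | grid_large n}.

Let bR k : 0 < (b ^ k)%:R :> R.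
Proof. by rewrite ltr0n expn_gt0 (ltnW hb). Qed.

Let dR : 1 <= d%:R :> R. Proof. by rewrite ler1n. Qed.

Lemma card_grid k : #|grid k|%:R <= 2 * (2 * b%:R) ^+ d * b%:R `^ (2 * d%:R * k%:R) :> R.
Proof.
rewrite card_sig (le_trans (y := #|grid_index k|%:R))//; first by rewrite ler_nat max_card.
rewrite card_prod card_ffun card_bool !card_ord natrM natrX natrM natrX exprS.
rewrite mulrC -mulrA ler_pM2l// mulrA exprMn ler_wpM2l//.
have -> : 2 * d%:R * k%:R = (2 * k * d)%:R :> R by rewrite !natrM mulrAC.
by rewrite powR_mulrn// -exprM.
Qed.

Lemma grid_coef_le (s : R) k m (h : cube_code d b m) (n : grid k) : 0 <= s <= 1 ->
  `|cube_coef h (phase (val n).2) (angular (grid_point (val n)))| <=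
  2 * d%:R * ((b ^ m)%:R)^-1 ^+ d * b%:R `^ (s * (m%:R - k%:R)).
Proof.
move=> /andP[s0 s1]; have b0 := ltnW hb.
have d0 : 0 < d%:R :> R by rewrite ltr0n.
have B1 : 1 <= b%:R :> R by rewrite ler1n.
set U := ((b ^ m)%:R)^-1 ^+ d.
have U0 : 0 <= U by rewrite exprn_ge0// invr_ge0.
have [km|mk] := leqP k m.
  rewrite (le_trans (cube_coef_le_vol b0 _ _ _))// -/U.
  have z1 : 1 <= b%:R `^ (s * (m%:R - k%:R)) :> R.
    rewrite -[leLHS](powRr0 (b%:R : R)); apply: ler_powR => //.
    by rewrite mulr_ge0// subr_ge0 ler_nat.
  rewrite mulrAC -[leLHS]mul1r ler_wpM2r//.
  by apply: mulr_ege1 => //; move: (dR); lra.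
case: n => n /= /existsP[i hi]; set g := grid_point n in hi *.
have g0 : 0 < `|tnth g i| by apply: lt_le_trans hi; rewrite divr_gt0// mulr_gt0.
have yE : tnth (angular g) i = - (2 * pi) * tnth g i by exact: tnth_angular.
have pi1 : 1 <= pi :> R by have := pi_ge2 R; lra.
(* The factor 2 pi of the angular frequency absorbs the 2 in [grid_large]. *)
have yi : (b ^ k)%:R / d%:R <= `|tnth (angular g) i|.
  rewrite yE mulNr normrN normrM ger0_norm; last by lra.
  apply: (@le_trans _ _ (2 * `|tnth g i|)); last by rewrite ler_pM2r//; lra.
  rewrite (_ : (b ^ k)%:R / d%:R = 2 * ((b ^ k)%:R / (2 * d%:R))) ?ler_pM2l//.
  by field; rewrite gt_eqF.
have y0 : 0 < `|tnth (angular g) i| by apply: lt_le_trans yi; rewrite divr_gt0.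
rewrite (le_trans (cube_coef_le_freq b0 _ _ (_ : tnth (angular g) i != 0)))//.
  by rewrite -normr_gt0.
rewrite -/U [leLHS]mulrC [leRHS]mulrAC ler_wpM2r//.
have -> : 2 * (b ^ m)%:R / `|tnth (angular g) i| = 2 * ((b ^ m)%:R / `|tnth (angular g) i|) by ring.
rewrite -mulrA ler_pM2l//.
apply: (@le_trans _ _ (d%:R * b%:R `^ (m%:R - k%:R))); last first.
  rewrite ler_wpM2l// ler_powR//.
  have : m%:R <= k%:R :> R by rewrite ler_nat ltnW.
  by move=> mk'; nra.
rewrite powRB; last by rewrite pnatr_eq0 -lt0n b0 implybT.
rewrite !powR_mulrn// -!natrX mulrCA ler_wpM2l//.
rewrite -[leRHS]invrK lef_pV2 ?posrE//; last by rewrite invr_gt0 divr_gt0.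
by rewrite invfM invrK mulrC.
Qed.

Lemma dotp_ge0 (x : Rd) : 0 <= dotp x x.
Proof. by apply: sumr_ge0 => i _; rewrite -expr2 sqr_ge0. Qed.

Lemma coord_le_enorm (x : Rd) i : `|tnth x i| <= enorm x.
Proof.
rewrite -sqrtr_sqr /enorm ler_sqrt ?dotp_ge0// /dotp (bigD1 i)//= expr2 lerDl.
by apply: sumr_ge0 => j _; rewrite -expr2 sqr_ge0.
Qed.

Lemma enorm_large_coord (x : Rd) : exists i, enorm x / d%:R <= `|tnth x i|.
Proof.
apply: contrapT => /forallNP H.
have d0 : 0 < d%:R :> R by rewrite ltr0n.
have e0 : 0 <= enorm x by exact: sqrtr_ge0.
have ei i : tnth x i * tnth x i < (enorm x / d%:R) ^+ 2.
  have /negP := H i; rewrite -ltNge => h.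
  by rewrite -expr2 -(real_normK (num_real (tnth x i))) ltrXn2r// nnegrE// divr_ge0// ltW.
have : dotp x x < \sum_(i < d) (enorm x / d%:R) ^+ 2.
  rewrite /dotp; apply: ltr_sum => //; first by apply/hasP; exists (Ordinal hd).
rewrite sumr_const card_ord -(mulr_natr (_ ^+ 2)) expr_div_n sqr_sqrtr ?dotp_ge0//.
rewrite (_ : _ / _ * _ = dotp x x / d%:R); last by field; rewrite gt_eqF.
rewrite ltNge => /negP; apply; rewrite ler_pdivrMr// ler_peMr// ?dotp_ge0//.
Qed.

(** Each coordinate is rounded down to the mesh. The condition 2d <= b^k keeps the error b^(-k)
    below half of the large coordinate, so the rounded point remains in [grid]. *)
Lemma grid_approx k (x : Rd) : (b ^ k)%:R <= enorm x < (b ^ k.+1)%:R ->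
  (2 * d <= b ^ k)%N ->
  exists n : {ffun 'I_d -> 'I_(2 * b ^ (2 * k).+1)},
    (forall e, grid_large (n, e)) /\
    forall e i, `|tnth x i - tnth (grid_point (n, e)) i| <= ((b ^ k)%:R)^-1.
Proof.
move=> /andP[xk xk1] dk; set Z := (b ^ (2 * k).+1)%N.
have ZE : Z%:R = (b ^ k.+1)%:R * (b ^ k)%:R :> R.
  by rewrite -natrM -expnD /Z; congr (_ ^ _)%:R; rewrite mul2n -addnn.
have xb i : `|tnth x i * (b ^ k)%:R| < Z%:R.
  rewrite normrM (ger0_norm (ltW (bR k))) ZE ltr_pM2r//.
  exact: le_lt_trans (coord_le_enorm x i) xk1.
have pos i : 0 <= tnth x i * (b ^ k)%:R + Z%:R.
  by have := xb i; rewrite ltr_norml => /andP[]; lra.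
have lt i : (Num.truncn (tnth x i * (b ^ k)%:R + Z%:R) < 2 * Z)%N.
  rewrite truncn_lt_nat// natrM; have := xb i; rewrite ltr_norml => /andP[]; lra.
pose n : {ffun 'I_d -> 'I_(2 * b ^ (2 * k).+1)} := [ffun i => Ordinal (lt i)].
have approx e i : `|tnth x i - tnth (grid_point (n, e)) i| <= ((b ^ k)%:R)^-1.
  rewrite tnth_mktuple /= ffunE /= -/Z.
  have /truncn_itv := pos i; set T := Num.truncn _ => /andP[T1 T2].
  rewrite -(ler_pM2r (bR k)) mulVf ?gt_eqF// -[X in _ * X <= _](ger0_norm (ltW (bR k))).
  rewrite -normrM mulrBl divfK ?gt_eqF// ler_norml; move: T2; rewrite -natr1; lra.
exists n; split=> // e; apply/existsP.
have [i xi] := enorm_large_coord x; exists i.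
have d0 : 0 < d%:R :> R by rewrite ltr0n.
have := approx e i; set g := tnth (grid_point _) i => gi.
have h1 : ((b ^ k)%:R)^-1 <= (b ^ k)%:R / (2 * d%:R) :> R.
  apply: (@le_trans _ _ 1).
    by rewrite invf_le1// ler1n expn_gt0 (ltnW hb).
  by rewrite ler_pdivlMr ?mulr_gt0// mul1r -natrM ler_nat.
have h2 : 2 * ((b ^ k)%:R / (2 * d%:R)) <= `|tnth x i|.
  apply: le_trans xi; rewrite (_ : 2 * _ = (b ^ k)%:R / d%:R) ?ler_pM2r ?invr_gt0//.
  by field; rewrite gt_eqF.
have := ler_normD g (tnth x i - g); rewrite addrC subrK.
by lra.
Qed.

(** * From the grid to all frequencies *)

Section decay.
Variable nu : {finite_measure set Rd -> \bar R}.

Definition trig_integral (a : R) (y : Rd) : R :=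
  \int[nu]_(t in @unit_cube R d) cos (a + dotp y t).

Let mU : measurable (@unit_cube R d). Proof. exact: measurable_unit_cube. Qed.

Lemma integrable_trig a (y : Rd) :
  nu.-integrable (@unit_cube R d) (EFin \o (fun t => cos (a + dotp y t))).
Proof.
apply: measurable_bounded_integrable => //.
- by rewrite ltey_eq fin_num_measure.
- by apply: measurable_funTS; exact: measurable_trig.
- exists 1; split; first exact: num_real.
  by move=> r r1 t _ /=; apply: (le_trans (cos_max _)); exact: ltW.
Qed.

Lemma trig_integral_lipschitz a (x y : Rd) (e : R) :
  (forall i, `|tnth x i - tnth y i| <= e) ->
  `|trig_integral a x - trig_integral a y| <= d%:R * e * fine (nu (@unit_cube R d)).
Proof.
move=> xye; rewrite /trig_integral -RintegralB//; [|exact: integrable_trig..].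
have iB : nu.-integrable (@unit_cube R d)
    (EFin \o (fun t => cos (a + dotp x t) - cos (a + dotp y t))).
  by apply: eq_integrable (integrableB mU (integrable_trig a x) (integrable_trig a y)) => // t _.
apply: le_trans (le_normr_Rintegral mU iB) _.
rewrite -Rintegral_cst//; apply: le_Rintegral => //.
- by have := integrable_abse iB; apply: eq_integrable => // t _.
- apply: measurable_bounded_integrable => //.
  + by rewrite ltey_eq fin_num_measure.
  + exists `|d%:R * e|; split; first exact: num_real.
    by move=> r r1 t _ /=; exact: ltW.
move=> t tU; apply: (le_trans (cos_lipschitz _ _)).
rewrite opprD addrACA subrr add0r /dotp -sumrB (le_trans (ler_norm_sum _ _ _))//.
rewrite mulr_natl -[X in _ *+ X](card_ord d) -sumr_const ler_sum// => i _.
have /andP[t0 t1] := tU i.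
by rewrite -mulrBl normrM (ger0_norm t0) (le_trans _ (xye i))// ler_piMr.
Qed.

Lemma fourierE (x : Rd) : Normc.normc (fourier nu x) ^+ 2 =
  trig_integral (phase false) (angular x) ^+ 2 +
  trig_integral (phase true) (angular x) ^+ 2.
Proof.
rewrite /fourier /Normc.normc sqr_sqrtr ?addr_ge0 ?sqr_ge0//.
congr (_ ^+ 2 + _ ^+ 2); apply: eq_Rintegral => t _; rewrite dotp_angular.
  by rewrite /phase add0r.
by rewrite /phase addrC -cosBpihalf.
Qed.

(** The Lipschitz error of rounding is O(b^(-k)), hence within the target b^(-sk) because s <= 1. *)
Lemma fourier_decay_of_grid (s K : R) : 0 <= s <= 1 -> 0 <= K ->
  (forall k (n : grid k),
    `|trig_integral (phase (val n).2) (angular (grid_point (val n)))| <=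
      K * b%:R `^ (- (s * k%:R))) ->
  fourier_decay nu (2 * s).
Proof.
move=> /andP[s0 s1] K0 HK.
have B1 : 1 <= b%:R :> R by rewrite ler1n ltnW.
have B0 : 0 < b%:R :> R by rewrite ltr0n ltnW.
pose mu := fine (nu (@unit_cube R d)).
have mu0 : 0 <= mu by exact: fine_ge0.
pose K2 := K + d%:R * (2 * pi) * mu.
have K20 : 0 <= K2 by rewrite addr_ge0// !mulr_ge0// pi_ge0.
(* The 2 counts the two phases, and b^(2s) pays for passing from b^k to |x| < b^(k+1). The threshold
   forces b^(k+1) > 2db, which gives the 2d <= b^k of [grid_approx]. *)
exists (2 * K2 ^+ 2 * b%:R `^ (2 * s)), (b * (2 * d))%:R => x xM.
set E := enorm x in xM *.
have E1 : 1 <= E by apply: le_trans xM; rewrite ler1n !muln_gt0 hd ltnW.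
pose k := trunc_log b (Num.truncn E).
have /andP[k1 k2] : (b ^ k <= Num.truncn E < b ^ k.+1)%N.
  by apply: trunc_log_bounds => //; rewrite truncn_gt0.
have E0 : 0 <= E by exact: le_trans E1.
have /andP[T1 T2] := truncn_itv E0.
have kE : (b ^ k)%:R <= E by apply: le_trans T1; rewrite ler_nat.
have Ek : E < (b ^ k.+1)%:R by apply: (lt_le_trans T2); rewrite ler_nat.
have dk : (2 * d <= b ^ k)%N.
  rewrite -(leq_pmul2l (ltnW hb)) -expnS ltnW// -(ltr_nat R).
  exact: le_lt_trans Ek.
have [n [nl napp]] := @grid_approx k x (introT andP (conj kE Ek)) dk.
have bound e : `|trig_integral (phase e) (angular x)| <= K2 * b%:R `^ (- (s * k%:R)).
  have hg := HK k (Sub (n, e) (nl e)); rewrite /= in hg.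
  have hl := @trig_integral_lipschitz (phase e) (angular x) (angular (grid_point (n, e)))
    (2 * pi * ((b ^ k)%:R)^-1).
  have {hl} hl := hl _; rewrite -/mu in hl.
  have {}hl : `|trig_integral (phase e) (angular x) -
      trig_integral (phase e) (angular (grid_point (n, e)))| <=
      d%:R * (2 * pi * ((b ^ k)%:R)^-1) * mu.
    apply: hl => i; rewrite !tnth_angular -mulrBr normrM normrN.
    by rewrite [`|2 * pi|]ger0_norm ?mulr_ge0 ?pi_ge0// ler_wpM2l ?mulr_ge0 ?pi_ge0.
  have hk : ((b ^ k)%:R)^-1 <= b%:R `^ (- (s * k%:R)) :> R.
    by rewrite natrX -powR_mulrn ?(ltW B0)// -powRN ler_powR// lerN2 ler_piMl.
  have : d%:R * (2 * pi * ((b ^ k)%:R)^-1) * mu <= d%:R * (2 * pi) * mu * b%:R `^ (- (s * k%:R)).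
    rewrite (_ : _ * mu = d%:R * (2 * pi) * mu * ((b ^ k)%:R)^-1); last by ring.
    by rewrite ler_wpM2l// !mulr_ge0// pi_ge0.
  rewrite /K2 mulrDl.
  have := ler_normD (trig_integral (phase e) (angular x) -
      trig_integral (phase e) (angular (grid_point (n, e))))
      (trig_integral (phase e) (angular (grid_point (n, e)))).
  rewrite subrK; lra.
have sq e : trig_integral (phase e) (angular x) ^+ 2 <= K2 ^+ 2 * b%:R `^ (- (2 * s * k%:R)).
  rewrite -(real_normK (num_real _)).
  have -> : b%:R `^ (- (2 * s * k%:R)) = (b%:R `^ (- (s * k%:R)) : R) ^+ 2.
    by rewrite -powR_mulrn ?powR_ge0// -powRrM; congr (_ `^ _); ring.
  by rewrite -exprMn lerXn2r ?nnegrE ?mulr_ge0 ?powR_ge0.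
rewrite fourierE; apply: (@le_trans _ _ (2 * K2 ^+ 2 * b%:R `^ (- (2 * s * k%:R)))).
  by have := sq false; have := sq true; lra.
rewrite -[leRHS]mulrA ler_wpM2l ?mulr_ge0 ?sqr_ge0//.
have Ep : 0 < E by exact: lt_le_trans E1.
have -> : b%:R `^ (- (2 * s * k%:R)) = b%:R `^ (2 * s) * (b ^ k.+1)%:R `^ (- (2 * s)) :> R.
  rewrite natrX -powR_mulrn ?ltW// -powRrM -powRD; last by rewrite (gt_eqF B0) implybT.
  by congr (_ `^ _); rewrite -natr1; ring.
rewrite ler_wpM2l ?powR_ge0// !powRN lef_pV2 ?posrE ?powR_gt0//.
by apply: ge0_ler_powR; rewrite ?nnegrE ?mulr_ge0// ltW.
Qed.

End decay.

End frequency_grid.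

(** * The lower bound for the Fourier dimension *)

Section weight_moments.
Local Open Scope ereal_scope.
Context (R : realType) (dQ : measure_display) (Omega' : measurableType dQ).
Context (Q : probability Omega' R) (W : {RV Q >-> R}).
Hypothesis W0 : \forall w \ae Q, (0 <= W w)%R.

Let mW : measurable_fun setT (W : Omega' -> R). Proof. exact: measurable_funP. Qed.

(** The moment estimates use |W|, so that powers are taken of numbers nonnegative everywhere and not
    only almost surely. *)
Lemma expectation_powR p :
  'E_Q[(fun w => W w `^ p)%R] = \int[Q]_x (`|W x| `^ p)%:E.
Proof.
rewrite unlock; apply: ge0_ae_eq_integral => //.
- by apply/measurable_EFinP/(measurableT_comp (measurable_powR p)).
- apply/measurable_EFinP/(measurableT_comp (measurable_powR p)).
  exact: measurableT_comp.
- by move=> x _; rewrite lee_fin powR_ge0.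
- by apply: filterS W0 => x Wx _; rewrite ger0_norm.
Qed.

Hypothesis EW1 : 'E_Q[W] = 1.
Variable p0 : R.
Hypothesis Wp0 : 'E_Q[(fun w => W w `^ p0)%R] < +oo.

Let mWp p : measurable_fun setT (fun x => (`|W x| `^ p)%:E).
Proof.
apply/measurable_EFinP/(measurableT_comp (measurable_powR p)).
exact: measurableT_comp.
Qed.

Lemma integrable_weight_powR p : (0 <= p <= p0)%R ->
  Q.-integrable setT (fun x => (`|W x| `^ p)%:E).
Proof.
move=> /andP[p_ge0 pp0].
have i0 : Q.-integrable setT (fun x => (`|W x| `^ p0)%:E).
  apply/integrableP; split => //.
  rewrite (eq_integral (fun x => (`|W x| `^ p0)%:E)) -?expectation_powR// => x _.
  by rewrite gee0_abs// lee_fin powR_ge0.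
apply: (@le_integrable _ _ _ _ _ _ _ (fun x => 1 + (`|W x| `^ p0)%:E)) => //.
- move=> x _; rewrite -EFinD !abse_EFin lee_fin.
  rewrite [leRHS]ger0_norm ?addr_ge0 ?powR_ge0// ger0_norm ?powR_ge0//.
  have [W1|/ltW W1] := leP `|W x|%R 1%R.
    apply: (@le_trans _ _ (1 `^ p)%R); first by apply: ge0_ler_powR; rewrite ?nnegrE.
    by rewrite powR1 lerDl powR_ge0.
  apply: (@le_trans _ _ (`|W x| `^ p0)%R); last by rewrite lerDr.
  exact: ler_powR.
- by apply: integrableD => //; exact: finite_measure_integrable_cst.
Qed.

(** Jensen's inequality through the tangent |x|^p >= 1 + p(x - 1), which is [powR_le_tangent] with
    exponent 1/p at |x|^p. It supplies the condition 1 <= a of [cascade_moment]. *)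
Lemma weight_moment_ge1 p : (1 < p <= p0)%R ->
  (1 <= fine 'E_Q[(fun w => W w `^ p)%R])%R.
Proof.
move=> /andP[p1 pp0].
have pge0 : (0 <= p)%R by rewrite (le_trans ler01) ?ltW.
have iWp : Q.-integrable setT (fun x => (`|W x| `^ p)%:E).
  by apply: integrable_weight_powR; rewrite pge0.
have iW : Q.-integrable setT (fun x => (W x)%:E).
  have : Q.-integrable setT (fun x => (`|W x| `^ 1)%:E).
    by apply: integrable_weight_powR; rewrite ler01 (le_trans (ltW p1)).
  apply: le_integrable => //; first exact/measurable_EFinP.
  by move=> x _; rewrite !abse_EFin powRr1// normr_id.
have tangent (x : R) : (1 - p + p * x <= `|x| `^ p)%R.
  have pp : (0 < p)%R by rewrite (lt_trans _ p1).
  have pV : (0 < p^-1 <= 1)%R by rewrite invr_gt0 pp invf_le1// ltW.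
  have := powR_le_tangent pV (powR_ge0 `|x| p).
  rewrite -powRrM divff ?gt_eqF// powRr1//.
  rewrite -(ler_pM2l pp) mulrDr mulrA divff ?gt_eqF// mul1r => h2.
  have : (p * x <= p * `|x|)%R by rewrite ler_pM2l// ler_norm.
  lra.
rewrite expectation_powR -lee_fin fineK ?integrable_fin_num//.
apply: (@le_trans _ _ (\int[Q]_x ((1 - p)%:E + p%:E * (W x)%:E))).
  rewrite integralD//; last 2 first.
  - exact: finite_measure_integrable_cst.
  - exact: integrableZl.
  rewrite integralZl// -expectation_def EW1 mule1.
  have := expectation_cst Q (1 - p)%R; rewrite unlock => ->.
  by rewrite -EFinD subrK.
apply: le_integral => //.
- by apply: integrableD => //; [exact: finite_measure_integrable_cst|exact: integrableZl].
- by move=> x _; rewrite -EFinM -EFinD lee_fin.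
Qed.

End weight_moments.

Lemma continuous_affine_form (R : realType) (d : nat) (a : R) (y : 'I_d -> R) :
  continuous (fun r : 'rV[R]_d => a + \sum_(i < d) y i * r ord0 i).
Proof.
move=> r.
have Ha : {for r, continuous (fun _ : 'rV[R]_d => a)} by exact: cst_continuous.
have Hi i : true -> (fun r0 : 'rV[R]_d => y i * r0 ord0 i) x @[x --> r] --> y i * r ord0 i.
  move=> _.
  have := @continuousM _ _ (fun _ : 'rV[R]_d => y i) (fun r0 : 'rV[R]_d => r0 ord0 i) r.
  by apply; [exact: cst_continuous|exact: coord_continuous].
have Hs : {for r, continuous (fun r0 : 'rV[R]_d => \sum_(i < d) y i * r0 ord0 i)}.
  have := @cvg_big _ _ +%R 0 xpredT (@add_continuous R) _ (nbhs r) (index_enum 'I_d)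
    (fun (i : 'I_d) (r0 : 'rV[R]_d) => y i * r0 ord0 i) _ _ Hi.
  exact.
exact: (continuousD Ha Hs).
Qed.

Lemma weak_limit_trig (R : realType) (d : nat) (rho : nat -> d.-tuple R -> R)
    (mu : {finite_measure set (d.-tuple R) -> \bar R}) a (y : d.-tuple R) :
  weak_limit rho mu ->
  \int[lebesgue_tuple R d]_(t in @unit_cube R d) (cos (a + dotp y t) * rho m t)
    @[m --> \oo] --> trig_integral mu a y.
Proof.
move=> [_ wl].
pose f (r : 'rV[R]_d) := cos (a + \sum_(i < d) tnth y i * r ord0 i).
have fE t : f (row_of_tuple t) = cos (a + dotp y t).
  by rewrite /f /dotp; congr (cos (_ + _)); apply: eq_bigr => i _; rewrite mxE.
have cf : continuous f.
  move=> r; apply: (@continuous_comp _ _ _ (fun r : 'rV[R]_d =>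
    a + \sum_(i < d) tnth y i * r ord0 i) cos); last exact: continuous_cos.
  exact: continuous_affine_form.
have := wl f (continuous_subspaceT cf).
rewrite /trig_integral.
have -> : \int[mu]_(t in @unit_cube R d) f (row_of_tuple t) =
    \int[mu]_(t in @unit_cube R d) cos (a + dotp y t).
  by apply: eq_Rintegral => t _.
have -> : (fun m => \int[lebesgue_tuple R d]_(t in @unit_cube R d)
      (f (row_of_tuple t) * rho m t)) =
    (fun m => \int[lebesgue_tuple R d]_(t in @unit_cube R d)
      (cos (a + dotp y t) * rho m t)).
  by apply/funext => m; apply: eq_Rintegral => t _; rewrite fE.
exact.
Qed.

(** * Decay of the cascade for a fixed exponent p *)

Section cascade_decay.
Context (R : realType) (d b : nat) (hd : (0 < d)%N) (hb : (1 < b)%N).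
Context (dQ : measure_display) (Omega' : measurableType dQ).
Context (Q : probability Omega' R) (W : {RV Q >-> R}).
Context (dO : measure_display) (Omega : measurableType dO).
Variable P : probability Omega R.
Context (X : cascade_index d b -> {RV P >-> R}).
Hypotheses (indepX : mutually_independent X) (lawX : forall I, same_law (X I) W).
Hypothesis EW1 : ('E_Q[W] = 1)%E.
Variable MC : Omega -> {finite_measure set (d.-tuple R) -> \bar R}.
Hypothesis MCP : \forall w \ae P, weak_limit (cascade_density (fun I => X I) w) (MC w).

Lemma cascade_decay (p a s s' : R) : 1 < p <= 2 -> 1 <= a ->
  (\int[Q]_x (`|W x| `^ p)%:E = a%:E)%E -> 0 <= s' < s -> s <= 1 ->
  b%:R `^ (d%:R * (1 - p) + s * p) * a < 1 ->
  \forall w \ae P, fourier_decay (MC w) (2 * s').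
Proof.
move=> p12 a1 EWp s's s1 theta1; have /andP[s'0 ss] := s's.
have A0 : 0 <= 2 * (2 * b%:R) ^+ d :> R by rewrite mulr_ge0// exprn_ge0// mulr_ge0.
have c0 : 0 <= 2 * d%:R :> R by rewrite mulr_ge0.
have s01 : 0 <= s <= 1 by rewrite s1 (le_trans s'0)// ltW.
have := grid_decay hb indepX lawX p12 EW1 a1 EWp s's A0 c0 theta1
  (card_grid R d b) (fun k m h (n : grid R d b k) => grid_coef_le hb hd h n s01).
apply: filterS2 MCP => w wl [K [K0 HK]].
apply: (fourier_decay_of_grid hb hd _ K0); first by rewrite s'0 (le_trans (ltW ss)).
move=> k n; apply: (HK k n).
have h := @weak_limit_trig R d _ _ (phase R (val n).2) (angular (grid_point R (val n))) wl.
(* Both sequences are shifted by one, since [integral_cascade_density] starts at level 1. *)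
rewrite -cvg_shiftS; rewrite -cvg_shiftS in h; apply: cvg_trans h.
apply: near_eq_cvg; apply: nearW => m /=.
by rewrite (integral_cascade_density (ltnW hb)).
Qed.

End cascade_decay.

Definition decay_exponent (R : realType) (d b : nat) (p m : R) : R :=
  2 * d%:R * (1 - p^-1) - 2 * logb b (m `^ p^-1).

Section exponent.
Context (R : realType) (d b : nat) (hb : (1 < b)%N).
Implicit Types p m s : R.

Let lnb : 0 < ln (b%:R : R). Proof. by rewrite ln_gt0// ltr1n. Qed.

Lemma decay_exponentE p m : p != 0 ->
  decay_exponent d b p m = 2 / p * (d%:R * (p - 1) - ln m / ln b%:R).
Proof.
move=> p0; rewrite /decay_exponent /logb ln_powR; field.
by rewrite p0 gt_eqF.
Qed.

(** [dimF] only sees exponents below d, so the bound must not exceed d: 2(1 - 1/p) <= 1 as p <= 2,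
    and the logarithm is nonnegative. *)
Lemma decay_exponent_le p m : 1 < p <= 2 -> 1 <= m -> decay_exponent d b p m <= d%:R.
Proof.
move=> /andP[p1 p2] m1; have p0 : 0 < p by lra.
rewrite decay_exponentE ?gt_eqF// -[leRHS]mul1r mulrBr.
have h : 0 <= 2 / p * (ln m / ln b%:R).
  apply: mulr_ge0; first by rewrite divr_ge0// ltW.
  by apply: divr_ge0; [exact: ln_ge0|exact: ltW].
have : 2 / p * (d%:R * (p - 1)) <= 1 * d%:R.
  rewrite [X in _ * X]mulrC mulrA ler_wpM2r//.
  by rewrite mulrAC ler_pdivrMr//; lra.
lra.
Qed.

(** The right side is the convergence condition theta < 1 of the series over levels. At s = 0 it
    compares m with b^(d(p-1)). *)
Lemma decay_exponent_gt p m s : 0 < p -> 0 < m -> (2 * s < decay_exponent d b p m) =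
  (b%:R `^ (d%:R * (1 - p) + s * p) * m < 1).
Proof.
move=> p0 m0; have B0 : 0 < b%:R :> R by rewrite ltr0n ltnW.
rewrite decay_exponentE ?gt_eqF//.
rewrite -[RHS](ltr_ln _ _) ?posrE ?mulr_gt0 ?powR_gt0// ln1 lnM ?posrE ?powR_gt0// ln_powR.
set L := ln b%:R; have L0 : 0 < L := lnb; set e := ln m.
rewrite -(ltr_pM2r (divr_gt0 (mulr_gt0 p0 L0) (ltr0n R 2))).
rewrite (_ : 2 / p * _ * _ = (d%:R * (p - 1)) * L - e); last first.
  by field; rewrite !gt_eqF.
rewrite (_ : 2 * s * _ = s * p * L); last by field.
by apply/idP/idP; lra.
Qed.

End exponent.

Lemma exists_half_between (R : realFieldType) (D e : R) : D < 2 -> D < e ->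
  exists s, [/\ D / 2 < s, s <= 1 & 2 * s < e].
Proof.
move=> D2 De; have h : D / 2 < Num.min 1 (e / 2) by rewrite lt_min; apply/andP; split; lra.
exists ((D / 2 + Num.min 1 (e / 2)) / 2).
have : Num.min 1 (e / 2) <= 1 by rewrite ge_min lexx.
have : Num.min 1 (e / 2) <= e / 2 by rewrite ge_min lexx orbT.
by move=> h1 h2; split; lra.
Qed.

Section dimF_lower_bound.
Context (R : realType) (d : nat) (nu : {finite_measure set (d.-tuple R) -> \bar R}).

Lemma dimF_ge (D : R) : 0 <= D < d%:R -> fourier_decay nu D -> D <= dimF nu.
Proof.
move=> D0d nuD; apply: ub_le_sup => //.
by exists d%:R => x [/andP[_ /ltW]].
Qed.

(** D itself may equal d, which [dimF] excludes, so D is approached from below; the index n+2 keeps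
    the approximants positive. *)
Lemma dimF_ge_of_sequence (D : R) : 0 < D <= d%:R ->
  (forall n : nat, fourier_decay nu (D * (1 - n.+2%:R^-1))) -> D <= dimF nu.
Proof.
move=> /andP[D0 Dd] decay; suff H (e : R) : 0 < e -> D <= dimF nu + e by apply/ler_addgt0Pr.
move=> e0.
pose n := Num.truncn (D / e).
have n0 : 0 < n.+2%:R :> R by rewrite ltr0n.
have nV : 0 < (n.+2%:R^-1 : R) <= 1 by rewrite invr_gt0 n0 invf_le1// ler1n.
have := @dimF_ge (D * (1 - n.+2%:R^-1)) _ (decay n).
have nVe : D * n.+2%:R^-1 <= e.
  rewrite ler_pdivrMr// mulrC -ler_pdivrMr//.
  have /truncn_itv/andP[_ /ltW h] : 0 <= D / e by rewrite divr_ge0// ltW.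
  by rewrite (le_trans h)// ler_nat.
have DV : 0 < D * n.+2%:R^-1 by rewrite mulr_gt0//; case/andP: nV.
have : 0 <= D * (1 - n.+2%:R^-1).
  by rewrite mulr_ge0 ?(ltW D0)// subr_ge0; case/andP: nV.
rewrite mulrBr mulr1 => h0 h.
have hD : D - D * n.+2%:R^-1 <= dimF nu.
  by apply: h; rewrite h0 (lt_le_trans _ Dd)// gtrBl.
by rewrite -lerBlDr (le_trans _ hD)// lerB.
Qed.

End dimF_lower_bound.

Theorem corollary1p7 (R : realType) (d b : nat) (hd : (1 <= d)%N) (hb : (2 <= b)%N)
  (dQ : measure_display) (Omega' : measurableType dQ) (Q : probability Omega' R)
  (W : {RV Q >-> R})
  (hW0 : \forall w \ae Q, 0 <= W w)
  (hW1 : ~ (\forall w \ae Q, W w = 1))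
  (hEW : ('E_Q[W] = 1)%E)
  (hWlog : ('E_Q[(fun w => W w * ln (W w))%R] < (d%:R * ln b%:R)%:E)%E)
  (hWeps : exists2 eps : R, 0 < eps & ('E_Q[(fun w => W w `^ (1 + eps))%R] < +oo)%E)
  (p0 : R) (hp0 : 1 < p0 <= 2)
  (hWp0 : ('E_Q[(fun w => W w `^ p0)%R] < (b%:R `^ (d%:R * (p0 - 1)))%:E)%E)
  (dO : measure_display) (Omega : measurableType dO) (P : probability Omega R)
  (WI : cascade_index d b -> {RV P >-> R})
  (hindep : mutually_independent WI)
  (hlaw : forall I, same_law (WI I) W)
  (MC : Omega -> {finite_measure set (d.-tuple R) -> \bar R})
  (hMC : \forall w \ae P, weak_limit (cascade_density (fun I => WI I) w) (MC w)) :
  let bound := Num.min 2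
    (sup [set 2 * d%:R * (1 - p^-1)
              - 2 * logb b (fine 'E_Q[(fun w => W w `^ p)%R] `^ p^-1)
         | p in [set p : R | 1 < p <= p0]]) in
  0 < bound /\
  \forall w \ae P, MC w setT != 0%E ->
    polynomial_fourier_decay (MC w) /\ bound <= dimF (MC w).

Proof.
move=> bound; have hb0 : (0 < b)%N := ltnW hb.
have /andP[p01 p02] := hp0.
have p00 : 0 < p0 by lra.
have Wp0_fin : ('E_Q[(fun w => W w `^ p0)%R] < +oo)%E by apply: lt_trans hWp0 (ltry _).
pose m p : R := fine 'E_Q[(fun w => W w `^ p)%R].
have mE p : 1 < p <= p0 -> (\int[Q]_x (`|W x| `^ p)%:E = (m p)%:E)%E.
  move=> /andP[p1 pp0]; rewrite /m expectation_powR// fineK// integrable_fin_num//.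
  by apply: (integrable_weight_powR hW0 Wp0_fin); rewrite pp0 (le_trans ler01) ?ltW.
have m1 p : 1 < p <= p0 -> 1 <= m p by exact: (weight_moment_ge1 hW0 hEW Wp0_fin).
pose A := [set decay_exponent d b p (m p) | p in [set p : R | 1 < p <= p0]].
have Ap0 : A (decay_exponent d b p0 (m p0)) by exists p0 => //=; rewrite p01 lexx.
have Aub x : A x -> x <= d%:R.
  move=> [p /= /andP[p1 pp0] <-]; apply: decay_exponent_le => //.
    by rewrite p1 (le_trans pp0).
  by apply: m1; rewrite p1.
have supA : has_ubound A by exists d%:R.
have boundE : bound = Num.min 2 (sup A) by [].
(* The moment hypothesis on p0 is the case s = 0 of [decay_exponent_gt]. *)
have ep0 : 0 < decay_exponent d b p0 (m p0).
  rewrite -[ltLHS](mulr0 2) decay_exponent_gt ?mul0r ?addr0//; last first.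
    by rewrite (lt_le_trans ltr01)// m1// p01 lexx.
  have : m p0 < b%:R `^ (d%:R * (p0 - 1)).
    have mp0 := mE p0; rewrite p01 lexx in mp0.
    by rewrite -lte_fin -mp0// -expectation_powR.
  rewrite -(ltr_pM2l (powR_gt0 (d%:R * (1 - p0)) (_ : 0 < b%:R :> R))) ?ltr0n//.
  move/lt_le_trans; apply; rewrite -powRD; last by rewrite pnatr_eq0 -lt0n hb0 implybT.
  by rewrite (_ : _ + _ = 0) ?powRr0//; ring.
have bound0 : 0 < bound.
  by rewrite boundE lt_min ltr0n/= (lt_le_trans ep0)// ub_le_sup.
have boundd : bound <= d%:R.
  rewrite boundE ge_min; apply/orP; right; apply: ge_sup => //.
  by exists (decay_exponent d b p0 (m p0)).
split=> //.
(* Being strictly below the supremum, D n is beaten by the exponent of some p, which may depend on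
   n; a sequence suffices and keeps the exceptional sets countable in number. *)
pose D n : R := bound * (1 - n.+2%:R^-1).
have Dn n : 0 < D n < bound.
  have h : 0 < (n.+2%:R^-1 : R) < 1 by rewrite invr_gt0 ltr0n/= invf_lt1 ?ltr1n.
  move/andP: h => [h1 h2]; rewrite mulr_gt0 ?subr_gt0//=.
  by rewrite gtr_pMr// gtrBl.
have decay n : \forall w \ae P, fourier_decay (MC w) (D n).
  have /andP[Dn0 Dnb] := Dn n.
  have : D n < sup A by rewrite (lt_le_trans Dnb)// boundE ge_min lexx orbT.
  move=> /sup_gt -/(_ (ex_intro _ _ Ap0))[_ [p /= /andP[p1 pp0] <-] Dp].
  have Dn2 : D n < 2 by rewrite (lt_le_trans Dnb)// boundE ge_min lexx.
  have m0 : 0 < m p by rewrite (lt_le_trans ltr01)// m1// p1.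
  have [s [Ds s1 sp]] := exists_half_between Dn2 Dp.
  rewrite (_ : D n = 2 * (D n / 2)); last by rewrite mulrCA divff ?mulr1.
  apply: (cascade_decay hd hb hindep hlaw hEW hMC (p := p) (a := m p) (s := s)).
  - by rewrite p1 (le_trans pp0).
  - by apply: m1; rewrite p1.
  - by apply: mE; rewrite p1.
  - by rewrite Ds andbT divr_ge0// ltW.
  - exact: s1.
  - by rewrite -(decay_exponent_gt d hb s (lt_trans ltr01 p1) m0).
apply: filterS (ae_foralln decay) => w Dw _; split.
  by exists (D 0%N) => //; case/andP: (Dn 0%N).
by apply: dimF_ge_of_sequence => //; rewrite bound0.
Qed.
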